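(* Let $K$ be a field of characteristic $0$, let $X_d=\{x_1,\ldots,x_d\}$ be a Jordan basis of the Weitzenböck derivation $\delta$ of the free metabelian associative algebra $F_d$, and let $\delta$ have a $1\times 1$ Jordan cell corresponding to $x_d$. Let $\delta$ act in the same way on $KU_d$ and $KV_d$. Let $\{c_1,\ldots,c_m\}$ be a homogeneous generating set of the $K[U_{d-1},V_{d-1}]^{\delta}$-module $(F_{d-1}')^{\delta}$. Let $\{e_1,\ldots,e_k,f_1,\ldots,f_l\}$ be a generating set of the algebra $K[U_{d-1},V_{d-1}]^{\delta}$, where $e_1,\ldots,e_k$ do not depend on $V_{d-1}$ and every monomial of $f_1,\ldots,f_l$ depends on $V_{d-1}$ (i.e., contains at least one of the variables $v_1,\ldots,v_{d-1}$). Then the $K[U_d,V_d]^{\delta}$-module $(F_d')^{\delta}$ is generated by the set \[ \{c_1,\ldots,c_m\}\cup\{\pi(f_1),\ldots,\pi(f_l)\}. \]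
   Context: All associative algebras are unitary over $K$. Let $A_d=K\langle x_1,\ldots,x_d\rangle$ be the free unitary associative algebra and $A_d'$ its commutator ideal. The free metabelian associative algebra is $F_d=A_d/(A_d')^2$, and $F_d'$ is its commutator ideal. $F_{d-1}$ is the analogous algebra on $X_{d-1}=\{x_1,\ldots,x_{d-1}\}$, viewed as a subalgebra of $F_d$. A Weitzenböck derivation $\delta$ of $F_d$ is a derivation acting on the vector space $KX_d$ with basis $X_d$ as a nonzero nilpotent linear operator. A Jordan basis is one in which the part $x_j,x_{j+1},\ldots,x_{j+p}$ of $X_d$ corresponding to a Jordan cell of size $p+1$ satisfies $\delta(x_j)=0$, $\delta(x_{j+k})=x_{j+k-1}$, $k=1,\ldots,p$. Thus here $\delta(x_d)=0$ and $KX_{d-1}$ is $\delta$-invariant. If $\delta(x_j)=\sum_i\alpha_{ij}x_i$, then $\delta$ acts as a derivation on the commutative polynomial algebra $K[U_d,V_d]=K[u_1,\ldots,u_d,v_1,\ldots,v_d]$ by $\delta(u_j)=\sum_i\alpha_{ij}u_i$, $\delta(v_j)=\sum_i\alpha_{ij}v_i$. For a $\delta$-invariant subspace $W$, $W^{\delta}=\{w\in W\mid\delta(w)=0\}$. $F_d'$ is a $K[U_d,V_d]$-module via $fu_i=x_if$, $fv_i=[f,x_i]=fx_i-x_if$ for $f\in F_d'$ (these operators commute by the metabelian identity); similarly for $d-1$. With this action $(F_d')^{\delta}$ is a $K[U_d,V_d]^{\delta}$-module and $(F_{d-1}')^{\delta}$ is a $K[U_{d-1},V_{d-1}]^{\delta}$-module.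 Let $K[U_{d-1},V_{d-1}]_{\omega}$ be the ideal of $K[U_{d-1},V_{d-1}]$ generated by $v_1,\ldots,v_{d-1}$ (equivalently $K[U_{d-1}]\otimes_K\omega(K[V_{d-1}])$, with $\omega(K[V_{d-1}])$ the polynomials without constant term). The $K$-linear map $\pi:K[U_{d-1},V_{d-1}]_{\omega}\to F_d'$ is defined on monomials, for $m\geq 0$, $n\geq 1$, by \[ \pi(u_{i_1}\cdots u_{i_m}v_{j_1}\cdots v_{j_n})=\left(\sum_{k=1}^n[x_d,x_{j_k}]\,v_{j_1}\cdots v_{j_{k-1}}v_{j_{k+1}}\cdots v_{j_n}\right)u_{i_1}\cdots u_{i_m}. \] Homogeneity is with respect to the gradings in which each $x_j,u_j,v_j$ has total degree $1$ and, if $x_j,\ldots,x_{j+p}$ correspond to a Jordan cell of size $p+1$, then $x_{j+k},u_{j+k},v_{j+k}$ have bidegree $(p-k,k)$. *)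

(* Defs.v *)
From HB Require Import structures.
From mathcomp Require Import all_boot all_order all_algebra.
From mathcomp Require Import generic_quotient ring_quotient.
From mathcomp Require Import boolp.
From mathcomp Require Import monalg mpoly.

Set Implicit Arguments.
Unset Strict Implicit.
Unset Printing Implicit Defensive.

Import GRing.Theory.
Local Open Scope ring_scope.
Local Open Scope quotient_scope.

Section TwoSidedIdeals.
Variable B : nzRingType.

Definition ideal_gen (S : B -> Prop) (f : B) : Prop :=
  exists (m : nat) (a s b : 'I_m -> B),
    (forall i, S (s i)) /\ f = \sum_(i < m) a i * s i * b i.

Definition comm_ideal : B -> Prop :=
  ideal_gen (fun f => exists a b, f = a * b - b * a).

Definition ideal_sq (I : B -> Prop) : B -> Prop :=
  ideal_gen (fun f => exists g h, I g /\ I h /\ f = g * h).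

Lemma ideal_gen0 S : ideal_gen S 0.
Proof.
exists 0, (fun _ => 0), (fun _ => 0), (fun _ => 0).
by split=> [[]//|]; rewrite big_ord0.
Qed.

Lemma ideal_genD S f g : ideal_gen S f -> ideal_gen S g -> ideal_gen S (f + g).
Proof.
move=> [m [a [s [b [Ss ->]]]]] [n [a' [s' [b' [Ss' ->]]]]].
pose gl T (u : 'I_m -> T) (v : 'I_n -> T) i :=
  match split i with inl j => u j | inr k => v k end.
exists (m + n)%N, (gl _ a a'), (gl _ s s'), (gl _ b b'); split=> [i|].
  by rewrite /gl; case: split.
rewrite big_split_ord /=; congr (_ + _); apply: eq_bigr => i _; rewrite /gl.
  by rewrite -[lshift _ _]/(unsplit (inl _)) unsplitK.
by rewrite -[rshift _ _]/(unsplit (inr _)) unsplitK.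
Qed.

Lemma ideal_genM S c f d : ideal_gen S f -> ideal_gen S (c * f * d).
Proof.
move=> [m [a [s [b [Ss ->]]]]].
exists m, (fun i => c * a i), s, (fun i => b i * d); split=> //.
rewrite mulr_sumr mulr_suml; apply: eq_bigr => i _; by rewrite !mulrA.
Qed.

Lemma ideal_genMl S c f : ideal_gen S f -> ideal_gen S (c * f).
Proof. by move/(@ideal_genM S c f 1); rewrite mulr1. Qed.

Lemma ideal_genMr S f d : ideal_gen S f -> ideal_gen S (f * d).
Proof. by move/(@ideal_genM S 1 f d); rewrite mul1r. Qed.

Lemma ideal_genN S f : ideal_gen S f -> ideal_gen S (- f).
Proof. by move/(@ideal_genMl S (-1)); rewrite mulN1r. Qed.

Lemma ideal_gen_sub (S : B -> Prop) f : S f -> ideal_gen S f.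
Proof.
move=> Sf; exists 1, (fun _ => 1), (fun _ => f), (fun _ => 1).
by split=> //; rewrite big_ord1 mulr1 mul1r.
Qed.

Lemma comm_ideal_comm (a b : B) : comm_ideal (a * b - b * a).
Proof. by apply: ideal_gen_sub; exists a, b. Qed.

End TwoSidedIdeals.

Lemma ideal_gen_morph (B C : nzRingType) (phi : {rmorphism B -> C})
    (S : B -> Prop) (T : C -> Prop) f :
  (forall s, S s -> T (phi s)) -> ideal_gen S f -> ideal_gen T (phi f).
Proof.
move=> ST [m [a [s [b [Ss ->]]]]].
exists m, (phi \o a), (phi \o s), (phi \o b); split=> [i|]; first exact: ST.
by rewrite rmorph_sum; apply: eq_bigr => i _; rewrite !rmorphM.
Qed.

Lemma comm_ideal_morph (B C : nzRingType) (phi : {rmorphism B -> C}) f :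
  comm_ideal f -> comm_ideal (phi f).
Proof.
apply: ideal_gen_morph => _ [a [b ->]]; exists (phi a), (phi b).
by rewrite rmorphB !rmorphM.
Qed.

Fact malg_scalerAr (M : monomType) (K : comNzRingType) (k : K)
    (a b : {malg K[M]}) : k *: (a * b) = a * (k *: b).
Proof.
apply: (proj1 (malgP (k *: (a * b)) _)) => w; rewrite monalg.mcoeffZ.
rewrite (mcoeffMlw w (finmap.fsubset_refl (monalg.msupp a))
  (finmap.fsubset_refl (monalg.msupp b))).
rewrite (mcoeffMlw _ (finmap.fsubset_refl _) (monalg.msuppZ_le k b)) mulr_sumr.
apply: eq_bigr => w1 _; rewrite mulr_sumr; apply: eq_bigr => w2 _.
by rewrite monalg.mcoeffZ -mulrnAr mulrCA mulrnAr mulrnAr.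
Qed.

(* The free unitary algebra on n generators: the algebra of the free monoid *)
Notation freeA K n := {malg K[{fmonom 'I_n}]}.

Section FreeAlgebra.
Variables (K : fieldType) (n : nat).

Section Eval.
Variables (B : algType K) (x : 'I_n -> B).

Definition word_eval (w : {fmonom 'I_n}) : B := \prod_(j <- (w : seq 'I_n)) x j.

Fact word_eval_morph : mmorphism word_eval.
Proof.
split=> [v w|]; rewrite /word_eval; first by rewrite fmM big_cat.
by rewrite fm1 big_nil.
Qed.
HB.instance Definition _ := isMultiplicative.Build _ _ word_eval word_eval_morph.

Definition free_eval : freeA K n -> B := monalg.mmap (in_alg B) word_eval.

HB.instance Definition _ := GRing.Additive.on free_eval.

Fact free_eval_multiplicative : monoid_morphism free_eval.
Proof.
have [|fM f1] := @monalg.commr_mmap_is_multiplicative _ _ _ (in_alg B) word_eval.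
  by move=> g m m'; apply/esym; rewrite /GRing.comm /= -scalerAr -scalerAl mulr1 mul1r.
by split.
Qed.
HB.instance Definition _ := GRing.isMonoidMorphism.Build (freeA K n) B free_eval
  free_eval_multiplicative.

Fact free_eval_scalable : scalable free_eval.
Proof.
move=> k a; rewrite /free_eval.
by rewrite (@monalg.mmapZ _ _ _ (in_alg B) word_eval) /= mulr_algl.
Qed.
HB.instance Definition _ := GRing.isScalable.Build K (freeA K n) B _ free_eval
  free_eval_scalable.

Lemma free_eval_gen i : free_eval << fmu i >> = x i.
Proof.
by rewrite /free_eval (@monalg.mmapU _ _ _ (in_alg B) word_eval) /= scale1r mul1r /word_eval fmU big_seq1.
Qed.
End Eval.

Definition metab_rel (f : freeA K n) : Prop := ideal_sq (@comm_ideal _) f.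
Definition metab_pred : {pred freeA K n} := fun f => `[< metab_rel f >].

Lemma metab_predP f : reflect (metab_rel f) (f \in metab_pred).
Proof. exact: asboolP. Qed.

Fact metab_pred_zmod : zmod_closed metab_pred.
Proof.
split=> [|f g /metab_predP If /metab_predP Ig]; apply/metab_predP.
  exact: ideal_gen0.
by apply: ideal_genD => //; apply: ideal_genN.
Qed.
HB.instance Definition _ := GRing.isZmodClosed.Build _ metab_pred metab_pred_zmod.

Lemma metab_rel_proper : ~ metab_rel 1.
Proof.
pose ev : {rmorphism freeA K n -> K^o} := free_eval (fun _ : 'I_n => 1 : K^o).
have ev0 f : comm_ideal f -> ev f = 0.
  move=> /(comm_ideal_morph ev) [m [a [s [b [Ss e]]]]].
  rewrite [LHS]e; apply: big1 => i _; have [c [d ->]] := Ss i.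
  by rewrite [d * c]mulrC subrr mulr0 mul0r.
case=> m [a [s [b [Ss /(congr1 ev)]]]]; rewrite rmorph1 rmorph_sum big1.
  by move/eqP; rewrite oner_eq0.
move=> i _; have [g [h [/ev0 g0 [_ ->]]]] := Ss i.
by rewrite !rmorphM g0 mul0r mulr0 mul0r.
Qed.

(* The free metabelian algebra F_n = A_n / (A_n')^2 *)
Definition FM : Type := Quotient.quot metab_pred.

HB.instance Definition _ := GRing.Zmodule.on FM.
HB.instance Definition _ : EqQuotient _ (Quotient.equiv metab_pred) FM :=
  EqQuotient.on FM.

Definition FMpi (a : freeA K n) : FM := \pi_FM a.

Lemma FMpiP a b : FMpi a = FMpi b <-> metab_rel (a - b).
Proof.
split=> [/eqP|ab].
  by rewrite /FMpi piE /Quotient.equiv => /metab_predP.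
by apply/eqP; rewrite /FMpi piE; apply/metab_predP.
Qed.

Lemma FMpi_repr (f : FM) : FMpi (repr f) = f.
Proof. exact: reprK. Qed.

Fact FMpi_additive : zmod_morphism FMpi.
Proof. by move=> a b; rewrite /FMpi Quotient.pi_add Quotient.pi_opp. Qed.
HB.instance Definition _ := GRing.isZmodMorphism.Build _ FM FMpi FMpi_additive.

Definition FM1 : FM := FMpi 1.
Definition FMmul (f g : FM) : FM := FMpi (repr f * repr g).
Definition FMscale (k : K) (f : FM) : FM := FMpi (k *: repr f).

Lemma FMpiM a b : FMpi (a * b) = FMmul (FMpi a) (FMpi b).
Proof.
apply/FMpiP.
set a' := repr _; set b' := repr _.
have Ia : metab_rel (a - a') by apply/FMpiP; rewrite FMpi_repr.
have Ib : metab_rel (b - b') by apply/FMpiP; rewrite FMpi_repr.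
have -> : a * b - a' * b' = (a - a') * b + a' * (b - b').
  by rewrite mulrBl mulrBr addrA subrK.
by apply: ideal_genD; [apply: ideal_genMr | apply: ideal_genMl].
Qed.

Lemma FMpiZ k a : FMpi (k *: a) = FMscale k (FMpi a).
Proof.
apply/FMpiP; set a' := repr _.
have Ia : metab_rel (a - a') by apply/FMpiP; rewrite FMpi_repr.
by rewrite -scalerBr -mulr_algl; apply: ideal_genMl.
Qed.

Local Ltac lift_repr :=
  repeat (let f := fresh "f" in move=> f; try rewrite -[f]FMpi_repr).

Fact FMmulA : associative FMmul.
Proof. by lift_repr; rewrite -!FMpiM mulrA. Qed.
Fact FMmul1 : left_id FM1 FMmul.
Proof. by lift_repr; rewrite -!FMpiM mul1r. Qed.
Fact FMmulr1 : right_id FM1 FMmul.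
Proof. by lift_repr; rewrite -!FMpiM mulr1. Qed.
Fact FMmulDl : left_distributive FMmul +%R.
Proof. by lift_repr; rewrite -raddfD -!FMpiM mulrDl raddfD. Qed.
Fact FMmulDr : right_distributive FMmul +%R.
Proof. by lift_repr; rewrite -raddfD -!FMpiM mulrDr raddfD. Qed.
Fact FM1_neq0 : FM1 != 0.
Proof.
apply/eqP; rewrite /FM1 -(raddf0 FMpi) => /FMpiP; rewrite subr0.
exact: metab_rel_proper.
Qed.
HB.instance Definition _ := GRing.Zmodule_isNzRing.Build FM
  FMmulA FMmul1 FMmulr1 FMmulDl FMmulDr FM1_neq0.

Fact FMscaleA a b f : FMscale a (FMscale b f) = FMscale (a * b) f.
Proof. by rewrite -[f]FMpi_repr -!FMpiZ scalerA. Qed.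
Fact FMscale1 : left_id 1 FMscale.
Proof. by lift_repr; rewrite -!FMpiZ scale1r. Qed.
Fact FMscaleDr : right_distributive FMscale +%R.
Proof.
move=> k f g; rewrite -[f]FMpi_repr -[g]FMpi_repr.
by rewrite -raddfD -!FMpiZ scalerDr raddfD.
Qed.
Fact FMscaleDl f : {morph FMscale^~ f : a b / a + b}.
Proof. by move=> a b /=; rewrite -[f]FMpi_repr -!FMpiZ scalerDl raddfD. Qed.
HB.instance Definition _ := GRing.Zmodule_isLmodule.Build K FM
  FMscaleA FMscale1 FMscaleDr FMscaleDl.

Fact FMscaleAl (k : K) (f g : FM) : k *: (f * g) = (k *: f) * g.
Proof.
change (FMscale k (FMmul f g) = FMmul (FMscale k f) g).
by rewrite -[f]FMpi_repr -[g]FMpi_repr -FMpiM -!FMpiZ -FMpiM scalerAl.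
Qed.
HB.instance Definition _ := GRing.Lmodule_isLalgebra.Build K FM FMscaleAl.

Fact FMscaleAr (k : K) (f g : FM) : k *: (f * g) = f * (k *: g).
Proof.
change (FMscale k (FMmul f g) = FMmul f (FMscale k g)).
by rewrite -[f]FMpi_repr -[g]FMpi_repr -FMpiM -!FMpiZ -FMpiM malg_scalerAr.
Qed.
HB.instance Definition _ := GRing.Lalgebra_isAlgebra.Build K FM FMscaleAr.

Fact FMpi_monoid : monoid_morphism FMpi.
Proof. by split=> [|a b]; [reflexivity | exact (FMpiM a b)]. Qed.
HB.instance Definition _ := GRing.isMonoidMorphism.Build _ FM FMpi FMpi_monoid.
Fact FMpi_scalable : scalable FMpi.
Proof. by move=> k a; exact: FMpiZ. Qed.
HB.instance Definition _ := GRing.isScalable.Build K _ FM _ FMpi FMpi_scalable.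

Definition FMgen (i : 'I_n) : FM := FMpi << fmu i >>.

Lemma comm_ideal_FMpi (f : FM) :
  comm_ideal f -> exists2 a, comm_ideal a & f = FMpi a.
Proof.
move=> [m [a [s [b [Ss ->]]]]]; apply: (big_ind (fun g => exists2 c, comm_ideal c & g = FMpi c)) => [|_ _ [c Ic ->] [d Id ->]|i _].
- by exists 0; [apply: ideal_gen0 | rewrite raddf0].
- by exists (c + d); [apply: ideal_genD | rewrite raddfD].
have [c [d ->]] := Ss i.
exists (repr (a i) * (repr c * repr d - repr d * repr c) * repr (b i)).
  by apply/ideal_genM/comm_ideal_comm.
rewrite 2!rmorphM raddfB /= !FMpi_repr; congr (_ * (_ - _) * _).
Qed.

Lemma FM_metabelian (f g : FM) : comm_ideal f -> comm_ideal g -> f * g = 0.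
Proof.
move=> /comm_ideal_FMpi[a Ia ->] /comm_ideal_FMpi[b Ib ->].
rewrite -rmorphM -[RHS](raddf0 FMpi) /=; apply/FMpiP; rewrite subr0.
by apply: ideal_gen_sub; exists a, b.
Qed.

End FreeAlgebra.

Section Embedding.
Variables (K : fieldType) (n : nat).

Definition widen1 : 'I_n -> 'I_n.+1 := widen_ord (leqnSn n).

(* F_n is identified with a subalgebra of F_{n+1} through FMemb *)
Definition FMemb (f : FM K n) : FM K n.+1 :=
  free_eval (fun i => FMgen K (widen1 i)) (repr f).

Lemma metab_rel_morph0 (phi : {rmorphism freeA K n -> FM K n.+1}) a :
  metab_rel a -> phi a = 0.
Proof.
move=> [m [c [s [d [Ss ->]]]]].
rewrite rmorph_sum big1 // => i _; have [g [h [Ig [Ih ->]]]] := Ss i.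
have gh0 : phi g * phi h = 0.
  by apply: FM_metabelian; apply: comm_ideal_morph.
by rewrite !rmorphM gh0 mulr0 mul0r.
Qed.

Lemma FMemb_pi (a : freeA K n) :
  FMemb (FMpi a) = free_eval (fun i => FMgen K (widen1 i)) a.
Proof.
rewrite /FMemb; apply/eqP; rewrite -subr_eq0 -raddfB; apply/eqP.
by apply: metab_rel_morph0; apply/FMpiP; rewrite FMpi_repr.
Qed.

Fact FMemb_additive : zmod_morphism FMemb.
Proof.
move=> f g; rewrite -[f]FMpi_repr -[g]FMpi_repr.
by rewrite -raddfB !FMemb_pi raddfB.
Qed.
HB.instance Definition _ :=
  GRing.isZmodMorphism.Build (FM K n) (FM K n.+1) FMemb FMemb_additive.

Fact FMemb_monoid : monoid_morphism FMemb.
Proof.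
split=> [|f g]; first by rewrite -(rmorph1 (@FMpi K n)) FMemb_pi rmorph1.
rewrite -[f]FMpi_repr -[g]FMpi_repr.
by rewrite -rmorphM !FMemb_pi rmorphM.
Qed.
HB.instance Definition _ :=
  GRing.isMonoidMorphism.Build (FM K n) (FM K n.+1) FMemb FMemb_monoid.

Fact FMemb_scalable : scalable FMemb.
Proof.
move=> k f; rewrite -[f]FMpi_repr.
by rewrite -linearZ !FMemb_pi linearZ.
Qed.
HB.instance Definition _ :=
  GRing.isScalable.Build K (FM K n) (FM K n.+1) _ FMemb FMemb_scalable.

Lemma FMemb_gen i : FMemb (FMgen K i) = FMgen K (widen1 i).
Proof. by rewrite FMemb_pi free_eval_gen. Qed.

End Embedding.

(* K[U_n, V_n] is mpoly (n + n) K: u_i is the variable lshift n i and v_i the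
   variable rshift n i *)
Notation polyUV K n := (mpoly (n + n) K).

Section Action.
Variables (K : fieldType) (B : algType K) (n : nat) (x : 'I_n -> B).

Definition act_var (k : 'I_(n + n)) (f : B) : B :=
  match split k with
  | inl i => x i * f
  | inr i => f * x i - x i * f
  end.

(* The order in which the variables act is irrelevant on the commutator ideal
   of a metabelian algebra, by act_varC below *)
Definition act_mon (m : multinom (n + n)) (f : B) : B :=
  foldr (fun k g => iter (m k) (act_var k) g) f (enum 'I_(n + n)).

Definition act (f : B) (p : polyUV K n) : B :=
  \sum_(m <- msupp p) p@_m *: act_mon m f.

Lemma act_var_comm_ideal k f : comm_ideal f -> comm_ideal (act_var k f).
Proof.
rewrite /act_var => If; case: split => i; first exact: ideal_genMl.
by apply: ideal_genD; [apply: ideal_genMr | apply/ideal_genN/ideal_genMl].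
Qed.

Lemma act_varC k l f :
    (forall g h : B, comm_ideal g -> comm_ideal h -> g * h = 0) ->
  comm_ideal f -> act_var k (act_var l f) = act_var l (act_var k f).
Proof.
move=> metab If.
have xl i j : x i * x j * f = x j * x i * f.
  apply/eqP; rewrite -subr_eq0 -mulrBl; apply/eqP/metab => //.
  exact: comm_ideal_comm.
have xr i j : f * (x i * x j) = f * (x j * x i).
  apply/eqP; rewrite -subr_eq0 -mulrBr; apply/eqP/metab => //.
  exact: comm_ideal_comm.
rewrite /act_var; case: split => i; case: split => j.
- by rewrite !mulrA xl.
- by rewrite mulrBr !mulrA xl.
- by rewrite mulrBr !mulrA xl.
rewrite !mulrBl !mulrBr -!mulrA xr [x i * (x j * f)]mulrA xl -mulrA.
by rewrite !opprD !opprK !addrA; congr (_ + _); rewrite addrAC.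
Qed.

End Action.

Section Weitzenboeck.
Variables (K : fieldType).

(* D is a derivation of F_n which acts on K X_n through the matrix alpha,
   D x_j = \sum_i alpha_ij x_i, and alpha is nilpotent and nonzero *)
Definition weitzenboeck n (D : {linear FM K n -> FM K n}) (alpha : 'M[K]_n) :=
  [/\ forall f g, D (f * g) = D f * g + f * D g,
      forall j, D (FMgen K j) = \sum_(i < n) alpha i j *: FMgen K i,
      alpha != 0 & exists N, alpha ^+ N = 0].

(* The Jordan cells are consecutive blocks of variables: s is the list of their
   sizes, so that variable number j belongs to the cell number
   reshape_index s j, where it has position reshape_offset s j. *)
Definition jordan_basis n (D : FM K n -> FM K n) (s : seq nat) :=
  [/\ sumn s = n, 0%N \notin s,
      forall j : 'I_n, reshape_offset s j = 0%N -> D (FMgen K j) = 0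
    & forall i j : 'I_n, reshape_offset s j != 0%N -> j = i.+1 :> nat ->
        D (FMgen K j) = FMgen K i].

(* The variable at position k in a cell of size p + 1 has bidegree (p - k, k) *)
Definition bideg2 (s : seq nat) (j : nat) : nat := reshape_offset s j.
Definition bideg1 (s : seq nat) (j : nat) : nat :=
  (nth 0 s (reshape_index s j)).-1 - reshape_offset s j.

Definition homogeneous n (s : seq nat) (f : FM K n) :=
  exists t b1 b2 : nat, exists2 a : freeA K n, f = FMpi a &
    forall w : {fmonom 'I_n}, monalg.mcoeff w a != 0 ->
      [/\ size w = t, \sum_(j <- (w : seq 'I_n)) bideg1 s j = b1
        & \sum_(j <- (w : seq 'I_n)) bideg2 s j = b2]%N.

Definition polyD n (alpha : 'M[K]_n) (p : polyUV K n) : polyUV K n :=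
  \sum_(j < n) ((\sum_(i < n) alpha i j *: 'X_(lshift n i)) * p^`M(lshift n j)
              + (\sum_(i < n) alpha i j *: 'X_(rshift n i)) * p^`M(rshift n j)).

Definition poly_const n (alpha : 'M[K]_n) (p : polyUV K n) : Prop :=
  polyD alpha p = 0.

Definition restr_mx n (alpha : 'M[K]_n.+1) : 'M[K]_n :=
  mxsub (@widen1 n) (@widen1 n) alpha.

Definition alg_generated_by N (R : mpoly N K -> Prop)
    (gs : seq (mpoly N K)) : Prop :=
  forall p, R p <-> exists q : mpoly (size gs) K, p = q \mPo (in_tuple gs).

(* cs generates M as a module over R, for the action of R on F_n *)
Definition mod_generated_by n (R : polyUV K n -> Prop) (M : FM K n -> Prop)
    (cs : seq (FM K n)) : Prop :=
  (forall c, c \in cs -> M c) /\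
  forall f, M f -> exists2 p : 'I_(size cs) -> polyUV K n,
    forall i, R (p i) & f = \sum_(i < size cs) act (@FMgen K n) cs`_i (p i).

Definition V_free n (p : polyUV K n) : Prop :=
  forall m, m \in msupp p -> forall j : 'I_n, m (rshift n j) = 0%N.

Definition V_dependent n (p : polyUV K n) : Prop :=
  forall m, m \in msupp p -> exists j : 'I_n, m (rshift n j) != 0%N.

(* The image under pi of a monomial m = u_{i_1}..u_{i_p} v_{j_1}..v_{j_q}: in
   the sum over k = 1..q the terms with j_k = j are equal, and there are
   m (rshift n j) of them. The value is 0 when q = 0, so that pi_map extends pi
   by 0 to the monomials outside the ideal generated by the v_j. *)
Definition pi_mon n (m : multinom (n + n)) : FM K n.+1 :=
  \sum_(j < n)
    act_mon (fun i => FMgen K (widen1 i)) (m - U_(rshift n j))%MM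
      (FMgen K ord_max * FMgen K (widen1 j)
       - FMgen K (widen1 j) * FMgen K ord_max) *+ m (rshift n j).

Definition pi_map n (p : polyUV K n) : FM K n.+1 :=
  \sum_(m <- msupp p) p@_m *: pi_mon m.

End Weitzenboeck.

(* Main.v *)
(** The Fox derivatives x_j |-> delta_ij of F_d take values in K[U_d,V_d], a
    bimodule on which x_j acts by u_j on the left and by u_j + v_j on the right.
    On F_d' they are K[U_d,V_d]-linear, and they identify F_d' with the kernel of
    (h_i) |-> \sum_i v_i h_i, because the Koszul complex of v_1, ..., v_d is exact
    in characteristic 0. Hence an identity in F_d' may be checked on Fox
    derivatives, that is, on polynomials.

    The derivative of pi(p) with respect to x_d is E(p), where E = \sum_j v_j d/dv_j
    is the Euler operator. If delta(f) = 0, then the derivative of f with respect to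
    x_d is a constant of delta; each of its coefficients as a polynomial in u_d, v_d
    lies in the ideal generated by the v_j and is therefore E(p) for a constant p.
    Subtracting the corresponding multiples of the elements pi(p) leaves an element
    whose derivative with respect to x_d vanishes, and the coefficients of its other
    derivatives come from constants in F_{d-1}'. Finally pi is a derivation that
    kills K[U_{d-1}], so the chain rule writes pi(p), for p a polynomial in the
    e_i and f_j, as a combination of the pi(f_j). *)
From HB Require Import structures.
Require Import Defs.
From mathcomp Require Import all_boot all_order all_algebra.
From mathcomp Require Import ring.
From mathcomp Require Import ssrcomplements.
From mathcomp Require Import mpoly.
From mathcomp Require monalg.
Import GRing.Theory.
Local Open Scope ring_scope.

Set Implicit Arguments.
Unset Strict Implicit.
Unset Printing Implicit Defensive.

(** * Auxiliary facts on polynomials: linear extension from monomials, partial derivatives, chain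
    rule *)

Lemma sum_delta_l (V : nmodType) (m : nat) (i : 'I_m) (F : 'I_m -> V) :
  (forall j, j != i -> F j = 0) -> \sum_j F j = F i.
Proof. by move=> F0; rewrite (bigD1 i) //= big1 ?addr0. Qed.

Lemma split_lshift m n (i : 'I_m) : split (lshift n i) = inl i.
Proof. exact: (unsplitK (inl i)). Qed.

Lemma split_rshift m n (i : 'I_n) : split (rshift m i) = inr i.
Proof. exact: (unsplitK (inr i)). Qed.

Lemma mpoly_alg_ind (R : fieldType) N (P : {mpoly R[N]} -> Prop) :
  (forall c, P c%:MP) -> (forall p q, P p -> P q -> P (p + q)) ->
  (forall i p, P p -> P ('X_i * p)) -> forall p, P p.
Proof.
move=> PC PD PM; elim/mpolyind => [|c m p _ _ Pp]; first by rewrite -mpolyC0.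
apply: (PD) Pp; rewrite mpolyXE_id -mul_mpolyC mulrC.
elim/big_rec: _ => [|i q _ Pq]; first by rewrite mul1r.
by rewrite -mulrA; elim: (m i) => [|k IH]; rewrite ?expr0 ?mul1r // exprS -mulrA;
  apply: PM.
Qed.

Section LinearExtension.
Variables (R : fieldType) (N : nat) (V : lmodType R) (g : 'X_{1..N} -> V).

(** [act] and [pi_map] have this shape, so their linearity is that of [mlin] by conversion. *)
Definition mlin (p : {mpoly R[N]}) : V := \sum_(m <- msupp p) p@_m *: g m.

(** The support of [p] gives way to an index set that can be shared by several polynomials, so that
    their sums can be compared term by term. *)
Lemma mlinwE p k : (msize p <= k)%N ->
  mlin p = \sum_(m : 'X_{1..N < k}) p@_m *: g m.
Proof.
pose I : subFinType _ := 'X_{1..N < k}.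
move=> lekp; rewrite /mlin (big_mksub I) /=; first last.
- by move=> x /msize_mdeg_lt /leq_trans; apply.
- by rewrite msupp_uniq.
by rewrite big_rmcond //= => i; move/memN_msupp_eq0 ->; rewrite scale0r.
Qed.

Fact mlin_is_linear : linear mlin.
Proof.
move=> c p q; pose k := maxn (msize (c *: p + q)%R) (maxn (msize p) (msize q)).
rewrite !(@mlinwE _ k) ?leq_max ?leqnn ?orbT // scaler_sumr -big_split /=.
by apply: eq_bigr => m _; rewrite mcoeffD mcoeffZ scalerDl scalerA.
Qed.
HB.instance Definition _ :=
  GRing.isLinear.Build R {mpoly R[N]} V _ mlin mlin_is_linear.

Lemma mlinX m : mlin 'X_[m] = g m.
Proof. by rewrite /mlin msuppX big_seq1 mcoeffX eqxx scale1r. Qed.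
End LinearExtension.

Lemma linear_mpolyP (R : fieldType) N (V : lmodType R)
    (f g : {linear {mpoly R[N]} -> V}) :
  (forall m, f 'X_[m] = g 'X_[m]) -> f =1 g.
Proof.
move=> fg p; rewrite (mpolyE p) !linear_sum; apply: eq_bigr => m _.
by rewrite !linearZ fg.
Qed.

Lemma mderivXU (R : nzRingType) N (i k : 'I_N) :
  ('X_k : {mpoly R[N]})^`M(i) = (k == i)%:R.
Proof.
rewrite mderivX mnm1E; case: eqP => [->|_]; last by rewrite scale0r.
have -> : (U_(i) - U_(i) = 0 :> 'X_{1..N})%MM.
  by apply/mnmP => l; rewrite mnmBE mnm0E subnn.
by rewrite mpolyX0 scale1r.
Qed.

(** The chain rule for substitution; it later expresses the image under [fox_pi] of a polynomial in
    the generators through the images of the generators. *)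
Lemma mderiv_comp (R : fieldType) N M (gs : N.-tuple {mpoly R[M]}) i q :
  (q \mPo gs)^`M(i) = \sum_(j < N) (q^`M(j) \mPo gs) * (tnth gs j)^`M(i).
Proof.
elim/mpoly_alg_ind: q => [c|p q IHp IHq|k p IHp].
- rewrite comp_mpolyC mderivC big1 // => j _.
  by rewrite mderivC comp_mpoly0 mul0r.
- rewrite comp_mpolyD mderivD IHp IHq -big_split /=; apply: eq_bigr => j _.
  by rewrite mderivD comp_mpolyD mulrDl.
rewrite rmorphM /= mderivM IHp comp_mpolyXU -tnth_nth.
have E j : ('X_k * p)^`M(j) \mPo gs =
    (k == j)%:R * (p \mPo gs) + tnth gs k * (p^`M(j) \mPo gs).
  rewrite mderivM comp_mpolyD !rmorphM /= mderivXU comp_mpolyXU -tnth_nth.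
  by rewrite rmorph_nat.
under [RHS]eq_bigr => j _ do rewrite E mulrDl -mulrA.
rewrite big_split /=; congr (_ + _).
  rewrite (bigD1 k) //= big1 ?addr0; last first.
    by move=> j /negbTE nk; rewrite eq_sym nk !mul0r.
  by rewrite eqxx mul1r mulrC.
by rewrite mulr_sumr; apply: eq_bigr => j _; rewrite mulrA.
Qed.

(** * The Euler operator E in the variables V and the inverses of E + c *)

Section PolyUV.
Variables (K : fieldType) (n : nat).
Implicit Types (p q : polyUV K n).

Notation u i := ('X_(lshift n i) : polyUV K n).
Notation v i := ('X_(rshift n i) : polyUV K n).
Notation dv i p := (mderiv (rshift n i) p).

Definition vdeg (m : 'X_{1..n + n}) : nat := \sum_(j < n) m (rshift n j).

Lemma vdegD m1 m2 : vdeg (m1 + m2)%MM = (vdeg m1 + vdeg m2)%N.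
Proof. by rewrite /vdeg -big_split; apply: eq_bigr => j _; rewrite mnmDE. Qed.

Lemma vdegU i : vdeg U_(rshift n i)%MM = 1%N.
Proof.
rewrite /vdeg (bigD1 i) //= big1 ?mnm1E ?eqxx // => j ji.
by rewrite mnm1E (inj_eq (@rshift_inj _ _)) eq_sym (negbTE ji).
Qed.

Definition vEuler p : polyUV K n := \sum_(j < n) v j * dv j p.

Fact vEuler_is_linear : linear vEuler.
Proof.
move=> c p q; rewrite /vEuler scaler_sumr -big_split; apply: eq_bigr => j _ /=.
by rewrite linearP mulrDr scalerAr.
Qed.
HB.instance Definition _ := GRing.isLinear.Build K (polyUV K n) (polyUV K n) _
  vEuler vEuler_is_linear.

Lemma vEulerX m : vEuler 'X_[m] = (vdeg m)%:R *: 'X_[m].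
Proof.
rewrite /vEuler /vdeg natr_sum scaler_suml; apply: eq_bigr => j _.
rewrite mderivX -scalerAr -mpolyXD.
case: (posnP (m (rshift n j))) => [->|m_gt0]; first by rewrite !scale0r.
by rewrite addmC submK // lep1mP -lt0n.
Qed.

(** Monomials are eigenvectors of E + c with eigenvalue [vdeg m + c], and this is the inverse
    operator. For c = 0 the monomials without V have eigenvalue 0; the convention 0^-1 = 0 sends
    them to 0. *)
Definition vEuler_inv (c : nat) : polyUV K n -> polyUV K n :=
  mlin (fun m => (vdeg m + c)%:R^-1 *: 'X_[m]).
HB.instance Definition _ c := GRing.Linear.on (vEuler_inv c).

Lemma vEuler_invX c m : vEuler_inv c 'X_[m] = (vdeg m + c)%:R^-1 *: 'X_[m].
Proof. exact: mlinX. Qed.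

(** Multiplication by v_i raises the degree in V by one, which amounts to replacing c by c + 1. *)
Lemma vEuler_inv_var c i p : vEuler_inv c (v i * p) = v i * vEuler_inv c.+1 p.
Proof.
apply: (linear_mpolyP (f := vEuler_inv c \o (v i \*o idfun))
  (g := (v i \*o idfun) \o vEuler_inv c.+1) _ p) => m /=.
rewrite -mpolyXD !vEuler_invX.
by rewrite -scalerAr -mpolyXD vdegD vdegU add1n addSnnS.
Qed.

Hypothesis charK : [pchar K] =i pred0.

(** For c > 0 every eigenvalue is a positive integer, hence invertible in characteristic 0. *)
Lemma vEulerK c : (0 < c)%N ->
  cancel (fun p => vEuler p + c%:R *: p) (vEuler_inv c).
Proof.
move=> c_gt0; apply: (@linear_mpolyP _ _ _
  (vEuler_inv c \o (vEuler \+ ( *:%R c%:R))) idfun) => m /=.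
rewrite vEulerX -scalerDl linearZ /= vEuler_invX scalerA -natrD divff ?scale1r //.
by rewrite ((pcharf0P K).1 charK) addn_eq0 negb_and orbC -lt0n c_gt0.
Qed.

Lemma vEuler_invK c : (0 < c)%N ->
  cancel (vEuler_inv c) (fun p => vEuler p + c%:R *: p).
Proof.
move=> c_gt0; apply: (@linear_mpolyP _ _ _
  ((vEuler \+ ( *:%R c%:R)) \o vEuler_inv c) idfun) => m /=.
rewrite vEuler_invX linearZ /= vEulerX !scalerA -scalerDl.
rewrite mulrC -mulrDl -natrD divff ?scale1r //.
by rewrite ((pcharf0P K).1 charK) addn_eq0 negb_and orbC -lt0n c_gt0.
Qed.

Lemma vEuler_var i p : vEuler (v i * p) = v i * (vEuler p + p).
Proof.
rewrite /vEuler; under eq_bigr => j _ do rewrite mderivM mulrDr [v j * (v i * _)]mulrCA.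
rewrite big_split /= -mulr_sumr addrC mulrDr; congr (_ + _).
rewrite (sum_delta_l (i := i)) => [|j ji]; first by rewrite mderivXU eqxx mul1r.
by rewrite mderivXU (inj_eq (@rshift_inj _ _)) eq_sym (negbTE ji) mul0r mulr0.
Qed.

(** A multiple of v_i has no monomial of degree 0 in V, so on it E itself is inverted; moving past
    v_i reduces this to c = 1. *)
Lemma vEuler_inv0K i p : vEuler (vEuler_inv 0 (v i * p)) = v i * p.
Proof.
rewrite vEuler_inv_var vEuler_var; congr (_ * _).
by rewrite -{2}[vEuler_inv 1 p]scale1r; apply: (vEuler_invK (c := 1)).
Qed.

End PolyUV.

(** * The derivation D of K[U,V] given by a matrix, and its commutation with E *)

Section PolyD.
Variables (K : fieldType) (n : nat) (alpha : 'M[K]_n).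
Implicit Types (p q : polyUV K n).
Notation u i := ('X_(lshift n i) : polyUV K n).
Notation v i := ('X_(rshift n i) : polyUV K n).
Notation dv i p := (mderiv (rshift n i) p).

Fact polyD_is_linear : linear (polyD alpha).
Proof.
move=> c p q; rewrite /polyD scaler_sumr -big_split; apply: eq_bigr => j _ /=.
by rewrite !linearP !mulrDr -!scalerAr scalerDr addrACA.
Qed.
HB.instance Definition _ := GRing.isLinear.Build K (polyUV K n) (polyUV K n) _
  (polyD alpha) polyD_is_linear.

Lemma polyDM p q : polyD alpha (p * q) = polyD alpha p * q + p * polyD alpha q.
Proof.
rewrite /polyD mulr_suml mulr_sumr -big_split; apply: eq_bigr => j _ /=.
by rewrite !mderivM; ring.
Qed.

Lemma polyDC c : polyD alpha c%:MP = 0.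
Proof. by rewrite /polyD big1 // => j _; rewrite !mderivC !mulr0 addr0. Qed.

Lemma polyD_u j : polyD alpha (u j) = \sum_(i < n) alpha i j *: u i.
Proof.
rewrite /polyD (bigD1 j) //= [X in _ + X]big1 ?addr0 => [|k kj]; last first.
  by rewrite !mderivXU (inj_eq (@lshift_inj _ _)) eq_lrshift eq_sym (negbTE kj) !mulr0 addr0.
by rewrite !mderivXU eqxx eq_lrshift mulr0 mulr1 addr0.
Qed.

Lemma polyD_v j : polyD alpha (v j) = \sum_(i < n) alpha i j *: v i.
Proof.
rewrite /polyD (bigD1 j) //= [X in _ + X]big1 ?addr0 => [|k kj]; last first.
  by rewrite !mderivXU (inj_eq (@rshift_inj _ _)) eq_rlshift eq_sym (negbTE kj) !mulr0 addr0.
by rewrite !mderivXU eqxx eq_rlshift mulr0 mulr1 add0r.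
Qed.

(** The commutator of d/dv_i with D is again a derivation, so it is determined by its values on the
    variables, computed in [dvX]. *)
Lemma mderiv_v_polyD i p :
  dv i (polyD alpha p) = polyD alpha (dv i p) + \sum_j alpha i j *: dv j p.
Proof.
elim/mpoly_alg_ind: p => [c|p q IHp IHq|k p IHp].
- rewrite polyDC linear0 mderivC linear0 big1 ?addr0 // => j _.
  by rewrite mderivC scaler0.
- rewrite !linearD /= IHp IHq addrACA; congr (_ + _).
  by rewrite -big_split; apply: eq_bigr => j _; rewrite linearD scalerDr.
have dvX : dv i (polyD alpha 'X_k) = \sum_j alpha i j *: dv j ('X_k : polyUV K n).
  case: (splitP k) => j kj.
    have -> : k = lshift n j by apply: val_inj.
    rewrite polyD_u linear_sum !big1 // => l _.
      by rewrite mderivXU eq_lrshift scaler0.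
    by rewrite linearZ /= mderivXU eq_lrshift scaler0.
  have -> : k = rshift n j by apply: val_inj.
  rewrite polyD_v linear_sum (bigD1 i) // [RHS](bigD1 j) //= !big1 ?addr0.
  + by rewrite linearZ /= !mderivXU !eqxx.
  + by move=> l lj; rewrite mderivXU (inj_eq (@rshift_inj _ _)) eq_sym (negbTE lj) scaler0.
  + by move=> l lj; rewrite linearZ /= mderivXU (inj_eq (@rshift_inj _ _)) (negbTE lj) scaler0.
have dvk l : polyD alpha (dv l ('X_k : polyUV K n)) = 0.
  by rewrite mderivXU -mpolyC_nat polyDC.
rewrite polyDM !mderivM !linearD /= !mderivM !polyDM IHp dvX dvk mul0r add0r.
have -> : \sum_j alpha i j *: dv j ('X_k * p) =
  (\sum_j alpha i j *: dv j ('X_k : polyUV K n)) * p + 'X_k * \sum_j alpha i j *: dv j p.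
  rewrite mulr_suml mulr_sumr -big_split; apply: eq_bigr => j _ /=.
  by rewrite mderivM scalerDr -scalerAl -scalerAr.
by ring.
Qed.

(** The commutator terms v_i alpha_ij dp/dv_j on the left match, after exchanging the sums, the
    terms D(v_j) dp/dv_j that the product rule creates on the right. *)
Lemma vEuler_polyD p : vEuler (polyD alpha p) = polyD alpha (vEuler p).
Proof.
rewrite /vEuler linear_sum /=.
under eq_bigr => i _ do rewrite mderiv_v_polyD mulrDr.
under [RHS]eq_bigr => i _ do rewrite polyDM polyD_v.
rewrite !big_split /= addrC; congr (_ + _).
under eq_bigr => i _ do rewrite mulr_sumr.
under [RHS]eq_bigr => i _ do rewrite mulr_suml.
rewrite exchange_big; apply: eq_bigr => i _; apply: eq_bigr => j _ /=.
by rewrite -scalerAr -scalerAl.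
Qed.

Hypothesis charK : [pchar K] =i pred0.

Lemma vEuler_inv_polyD c p : (0 < c)%N ->
  vEuler_inv c (polyD alpha p) = polyD alpha (vEuler_inv c p).
Proof.
move=> c_gt0; rewrite -{1}(vEuler_invK charK c_gt0 p) linearD linearZ /=.
by rewrite -vEuler_polyD vEulerK.
Qed.

(** D maps the ideal generated by V to itself: by the product rule D(v_i p) is a sum of multiples of
    variables v_j, and on each of them c = 0 may be traded for c = 1. *)
Lemma vEuler_inv0_polyD i p :
  vEuler_inv 0 (polyD alpha (v i * p)) = polyD alpha (vEuler_inv 0 (v i * p)).
Proof.
rewrite vEuler_inv_var !polyDM linearD /= vEuler_inv_var vEuler_inv_polyD //.
congr (_ + _); rewrite polyD_v !mulr_suml linear_sum; apply: eq_bigr => j _ /=.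
by rewrite -!scalerAl linearZ /= vEuler_inv_var.
Qed.

End PolyD.

(** * Splitting off the variables u_d and v_d from K[U_d,V_d] *)

Section LastVariables.
Variables (K : fieldType) (n : nat).
Implicit Types (p q : polyUV K n) (r : polyUV K n.+1).
Notation ud := ('X_(lshift n.+1 ord_max) : polyUV K n.+1).
Notation vd := ('X_(rshift n.+1 ord_max) : polyUV K n.+1).

Lemma widen1_lift (i : 'I_n) : widen1 i = lift ord_max i.
Proof. by apply: val_inj; rewrite /= /bump leqNgt ltn_ord. Qed.

Lemma ord_widenP (P : 'I_n.+1 -> Prop) :
  (forall i, P (widen1 i)) -> P ord_max -> forall i, P i.
Proof.
move=> PW Pm i; case: (unliftP ord_max i) => [j|] -> //.
by rewrite -widen1_lift; apply: PW.
Qed.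

Lemma widen1_inj : injective (@widen1 n).
Proof. by move=> i j e; apply: val_inj; exact: (congr1 val e). Qed.

Lemma widen1_neq_max (i : 'I_n) : (widen1 i == ord_max) = false.
Proof. by apply/eqP => /(congr1 val) /= e; have := ltn_ord i; rewrite e ltnn. Qed.

Lemma big_ord_widen1 (V : nmodType) (F : 'I_n.+1 -> V) :
  \sum_i F i = \sum_i F (widen1 i) + F ord_max.
Proof. by rewrite big_ord_recr. Qed.

Definition uv_widen (k : 'I_(n + n)) : 'I_(n.+1 + n.+1) :=
  match split k with
  | inl i => lshift n.+1 (widen1 i)
  | inr i => rshift n.+1 (widen1 i)
  end.

Lemma uv_widenl i : uv_widen (lshift n i) = lshift n.+1 (widen1 i).
Proof. by rewrite /uv_widen split_lshift. Qed.

Lemma uv_widenr i : uv_widen (rshift n i) = rshift n.+1 (widen1 i).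
Proof. by rewrite /uv_widen split_rshift. Qed.

Definition poly_widen : polyUV K n -> polyUV K n.+1 :=
  comp_mpoly [tuple 'X_(uv_widen k) | k < n + n].
HB.instance Definition _ := GRing.LRMorphism.on poly_widen.

Lemma poly_widenX k : poly_widen 'X_k = 'X_(uv_widen k).
Proof. by rewrite /poly_widen comp_mpolyXU -tnth_nth tnth_mktuple. Qed.

Lemma poly_widenC c : poly_widen c%:MP = c%:MP.
Proof. exact: comp_mpolyC. Qed.

Variant uv_spec : 'I_(n.+1 + n.+1) -> Type :=
| UvWiden k : uv_spec (uv_widen k)
| UvMaxU : uv_spec (lshift n.+1 ord_max)
| UvMaxV : uv_spec (rshift n.+1 ord_max).

Lemma uvP k : uv_spec k.
Proof.
case: (split_ordP k) => i ->; case: (unliftP ord_max i) => [j|] ->;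
  rewrite -?widen1_lift -?uv_widenl -?uv_widenr; by constructor.
Qed.

Lemma uvd_ind (P : polyUV K n.+1 -> Prop) :
  (forall r1 r2, P r1 -> P r2 -> P (r1 + r2)) ->
  (forall a b q, P (ud ^+ a * vd ^+ b * poly_widen q)) -> forall r, P r.
Proof.
move=> PD PM p.
(* The prefix collects the variables already met: each new variable raises [a], raises [b] or is
   absorbed into [q]. *)
suff: forall a b q, P (ud ^+ a * vd ^+ b * poly_widen q * p).
  by move=> /(_ 0%N 0%N 1); rewrite rmorph1 !expr0 !mul1r.
elim/mpoly_alg_ind: p => [c|p1 p2 IH1 IH2|k p IH] a b q.
- by rewrite -(poly_widenC c) -mulrA -rmorphM.
- by rewrite mulrDr; apply: PD.
case: k / uvP => [k||].
- by rewrite -poly_widenX mulrA -[_ * poly_widen 'X_k]mulrA -rmorphM.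
- have -> : ud ^+ a * vd ^+ b * poly_widen q * (ud * p) =
            ud ^+ a.+1 * vd ^+ b * poly_widen q * p by rewrite exprS; ring.
  exact: IH.
have -> : ud ^+ a * vd ^+ b * poly_widen q * (vd * p) =
            ud ^+ a * vd ^+ b.+1 * poly_widen q * p by rewrite exprS; ring.
exact: IH.
Qed.

Definition uvd_var (k : 'I_(n.+1 + n.+1)) : {poly {poly polyUV K n}} :=
  match split k with
  | inl i => if unlift ord_max i is Some j then ('X_(lshift n (j : 'I_n)))%:P%:P else 'X
  | inr i => if unlift ord_max i is Some j then ('X_(rshift n (j : 'I_n)))%:P%:P else 'X%:P
  end.

(* K[U_d,V_d] as polynomials in u_d (outer) and v_d (inner) over the other
   variables. *)
Definition uvd_poly : polyUV K n.+1 -> {poly {poly polyUV K n}} :=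
  mmap (polyC \o polyC \o @mpolyC (n + n) K) uvd_var.
HB.instance Definition _ := GRing.RMorphism.on uvd_poly.

Lemma uvd_polyX k : uvd_poly 'X_k = uvd_var k.
Proof. by rewrite /uvd_poly mmapX mmap1U. Qed.

Lemma uvd_poly_ud : uvd_poly ud = 'X.
Proof.
by rewrite uvd_polyX /uvd_var split_lshift unlift_none.
Qed.

Lemma uvd_poly_vd : uvd_poly vd = 'X%:P.
Proof.
by rewrite uvd_polyX /uvd_var split_rshift unlift_none.
Qed.

Lemma uvd_poly_widen p : uvd_poly (poly_widen p) = p%:P%:P.
Proof.
elim/mpoly_alg_ind: p => [c|p q IHp IHq|k p IHp].
- by rewrite poly_widenC /uvd_poly mmapC.
- by rewrite !rmorphD /= IHp IHq.
rewrite !rmorphM /= IHp poly_widenX uvd_polyX; congr (_ * _) => {p IHp}.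
rewrite /uvd_var; case: (split_ordP k) => i ->.
  rewrite uv_widenl split_lshift.
  by rewrite widen1_lift liftK.
rewrite uv_widenr split_rshift.
by rewrite widen1_lift liftK.
Qed.

Definition uvd_coef (a b : nat) r : polyUV K n := (uvd_poly r)`_a`_b.

Fact uvd_coef_is_linear a b : linear (uvd_coef a b).
Proof.
move=> c p q; rewrite /uvd_coef rmorphD -mul_mpolyC rmorphM /=.
have -> : uvd_poly c%:MP = c%:MP%:P%:P by rewrite -poly_widenC uvd_poly_widen.
by rewrite coefD coefCM coefD coefCM mul_mpolyC.
Qed.
HB.instance Definition _ a b := GRing.isLinear.Build K (polyUV K n.+1)
  (polyUV K n) _ (uvd_coef a b) (uvd_coef_is_linear a b).

Lemma uvd_coef_widen a b p r : uvd_coef a b (poly_widen p * r) = p * uvd_coef a b r.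
Proof. by rewrite /uvd_coef rmorphM /= uvd_poly_widen !coefCM. Qed.

Lemma uvd_coef_mulvd a b r : uvd_coef a b.+1 (vd * r) = uvd_coef a b r.
Proof. by rewrite /uvd_coef rmorphM /= uvd_poly_vd coefCM coefXM. Qed.

Lemma uvd_coefX a b a' b' p :
  uvd_coef a b (ud ^+ a' * vd ^+ b' * poly_widen p) = ((a == a') && (b == b'))%:R * p.
Proof.
rewrite mulrC uvd_coef_widen mulrC; congr (_ * _).
rewrite /uvd_coef rmorphM !rmorphXn /= uvd_poly_ud uvd_poly_vd -rmorphXn /=.
rewrite coefMC coefXn; case: (a == a'); last by rewrite mul0r coef0.
by rewrite mul1r coefXn.
Qed.

(** The expansion holds for every sufficiently large bound, so that several polynomials can later
    share one. *)
Lemma uvd_coefE r : exists B, forall B', (B <= B')%N ->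
  r = \sum_(a < B') \sum_(b < B') ud ^+ a * vd ^+ b * poly_widen (uvd_coef a b r).
Proof.
elim/uvd_ind: r => [p q [B1 E1] [B2 E2]|a b q].
  exists (maxn B1 B2) => B; rewrite geq_max => /andP[/E1 {1}-> /E2 {1}->].
  rewrite -big_split; apply: eq_bigr => a _; rewrite -big_split.
  by apply: eq_bigr => b _ /=; rewrite !linearD mulrDr.
exists (maxn a b).+1 => B ltB.
have ltaB : (a < B)%N by apply: leq_trans ltB; rewrite ltnS leq_maxl.
have ltbB : (b < B)%N by apply: leq_trans ltB; rewrite ltnS leq_maxr.
rewrite (bigD1 (Ordinal ltaB)) //= (bigD1 (Ordinal ltbB)) //= !big1 ?addr0.
- by rewrite uvd_coefX !eqxx mul1r.
- move=> i /negbTE ia; apply: big1 => j _.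
  by rewrite uvd_coefX (_ : (i == a :> nat) = false) //= mul0r linear0 mulr0.
move=> j /negbTE jb.
by rewrite uvd_coefX (_ : (j == b :> nat) = false) // andbF mul0r linear0 mulr0.
Qed.

Section PolyD.
Variable alpha : 'M[K]_n.+1.
Hypothesis alphar : forall i, alpha i ord_max = 0.
Hypothesis alphal : forall j, alpha ord_max j = 0.

Lemma polyD_ud : polyD alpha ud = 0.
Proof. by rewrite polyD_u big1 // => i _; rewrite alphar scale0r. Qed.

Lemma polyD_vd : polyD alpha vd = 0.
Proof. by rewrite polyD_v big1 // => i _; rewrite alphar scale0r. Qed.

Lemma polyD_widen p :
  polyD alpha (poly_widen p) = poly_widen (polyD (restr_mx alpha) p).
Proof.
elim/mpoly_alg_ind: p => [c|p q IHp IHq|k p IHp].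
- by rewrite poly_widenC !polyDC linear0.
- by rewrite !linearD /= IHp IHq.
rewrite rmorphM !polyDM rmorphD !rmorphM /= IHp; congr (_ * _ + _).
rewrite !poly_widenX; case: (split_ordP k) => j ->.
  rewrite uv_widenl !polyD_u big_ord_widen1 alphal scale0r addr0 linear_sum.
  by apply: eq_bigr => i _; rewrite linearZ /= poly_widenX uv_widenl mxE.
rewrite uv_widenr !polyD_v big_ord_widen1 alphal scale0r addr0 linear_sum.
by apply: eq_bigr => i _; rewrite linearZ /= poly_widenX uv_widenr mxE.
Qed.

Lemma polyDX0 r k : polyD alpha r = 0 -> polyD alpha (r ^+ k) = 0.
Proof.
move=> r0; elim: k => [|k IH]; first by rewrite expr0 -mpolyC1 polyDC.
by rewrite exprS polyDM r0 IH mul0r mulr0 addr0.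
Qed.

Lemma polyD_uvd a b r :
  polyD alpha (ud ^+ a * vd ^+ b * r) = ud ^+ a * vd ^+ b * polyD alpha r.
Proof.
by rewrite !polyDM !(polyDX0 _ polyD_ud) !(polyDX0 _ polyD_vd) mul0r mulr0 add0r mul0r add0r.
Qed.

(** The zero last column of [alpha] makes D kill u_d and v_d, and the zero last row makes D preserve
    the polynomials in the other variables; hence D acts coefficient by coefficient. *)
Lemma uvd_coef_polyD a b r :
  uvd_coef a b (polyD alpha r) = polyD (restr_mx alpha) (uvd_coef a b r).
Proof.
elim/uvd_ind: r => [p q IHp IHq|a' b' q]; first by rewrite !linearD /= IHp IHq.
rewrite polyD_uvd polyD_widen !uvd_coefX.
by case: (_ && _); rewrite ?mul1r // !mul0r linear0.
Qed.
End PolyD.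
End LastVariables.

(** * The action of K[U,V] on the commutator ideal *)

Section ActTheory.
Variables (K : fieldType) (B : algType K) (n : nat) (x : 'I_n -> B).
Implicit Types (f g : B) (k l : 'I_(n + n)) (m : 'X_{1..n + n}).

Fact act_var_is_linear k : linear (act_var x k).
Proof.
move=> c f g; rewrite /act_var; case: split => i.
  by rewrite mulrDr scalerAr.
by rewrite mulrDr mulrDl scalerBr scalerAl scalerAr opprD addrACA.
Qed.
HB.instance Definition _ k :=
  GRing.isLinear.Build K B B _ (act_var x k) (act_var_is_linear k).

HB.instance Definition _ f := GRing.isLinear.Build K (polyUV K n) B _ (act x f)
  (mlin_is_linear (fun m => act_mon x m f)).

Lemma actX f m : act x f 'X_[m] = act_mon x m f.
Proof. exact: (mlinX (fun m => act_mon x m f)). Qed.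

Lemma act1 f : act x f 1 = f.
Proof.
rewrite -mpolyX0 actX /act_mon; elim: (enum _) => //= k s ->.
by rewrite mnm0E.
Qed.

Lemma comm_idealZ c f : comm_ideal f -> comm_ideal (c *: f).
Proof. by move=> If; rewrite -mulr_algl; apply: ideal_genMl. Qed.

Lemma comm_ideal_sum (I : Type) (r : seq I) (P : pred I) (F : I -> B) :
  (forall i, P i -> comm_ideal (F i)) -> comm_ideal (\sum_(i <- r | P i) F i).
Proof.
by move=> IF; apply: big_ind => //; [apply: ideal_gen0 | apply: ideal_genD].
Qed.

Lemma act_iter_comm_ideal k i f : comm_ideal f -> comm_ideal (iter i (act_var x k) f).
Proof. by move=> If; elim: i => //= i; apply: act_var_comm_ideal. Qed.

Lemma act_mon_comm_ideal m f : comm_ideal f -> comm_ideal (act_mon x m f).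
Proof.
move=> If; rewrite /act_mon; elim: (enum _) => //= k s.
exact: act_iter_comm_ideal.
Qed.

Lemma act_comm_ideal f p : comm_ideal f -> comm_ideal (act x f p).
Proof.
by move=> If; apply: comm_ideal_sum => m _; apply/comm_idealZ/act_mon_comm_ideal.
Qed.

(** The scalars [e] are left free because two cases occur: the variables themselves, and their
    images under [poly_widen] when only the first d-1 generators act. *)
Lemma act_mon_eigen (R : comNzRingType) (F : B -> R) (e : 'I_(n + n) -> R) :
  (forall k f, comm_ideal f -> F (act_var x k f) = e k * F f) ->
  forall m f, comm_ideal f -> F (act_mon x m f) = mmap1 e m * F f.
Proof.
move=> Fe m f If; rewrite /act_mon /mmap1 -big_enum /=.
elim: (enum _) => [|k s IH] /=; first by rewrite big_nil mul1r.
rewrite big_cons -mulrA -IH; elim: (m k) => [|i IHi]; first by rewrite expr0 mul1r.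
rewrite iterS Fe ?IHi ?exprS ?mulrA //.
by apply: act_iter_comm_ideal; elim: s {IH IHi} => //= l s; apply: act_iter_comm_ideal.
Qed.

Hypothesis metab : forall g h : B, comm_ideal g -> comm_ideal h -> g * h = 0.

Lemma act_var_iter k l i f : comm_ideal f ->
  act_var x k (iter i (act_var x l) f) = iter i (act_var x l) (act_var x k f).
Proof.
move=> If; elim: i => //= i <-; apply: act_varC => //.
exact: act_iter_comm_ideal.
Qed.

Lemma act_var_act_mon k m f : comm_ideal f ->
  act_mon x m (act_var x k f) = act_var x k (act_mon x m f).
Proof.
move=> If; rewrite /act_mon; elim: (enum _) => //= l s ->.
rewrite act_var_iter //; elim: s => //= j s; exact: act_iter_comm_ideal.
Qed.

Lemma act_mon_var k m f : comm_ideal f ->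
  act_mon x (U_(k) + m) f = act_var x k (act_mon x m f).
Proof.
move=> If; rewrite /act_mon.
(* Generalised to sublists of the fixed order of variables: the additional operator is applied
   exactly when [k] has been passed, and only once since the list has no repetition. It is brought
   to the front by commutation. *)
suff E s : uniq s -> foldr (fun l g => iter ((U_(k) + m)%MM l) (act_var x l) g) f s =
    (if k \in s then act_var x k else id)
      (foldr (fun l g => iter (m l) (act_var x l) g) f s).
  by rewrite E ?enum_uniq // mem_enum.
have Is s' : comm_ideal (foldr (fun l g => iter (m l) (act_var x l) g) f s').
  by elim: s' => //= l s'; apply: act_iter_comm_ideal.
elim: s => //= l s IH /andP[ls /IH ->]; rewrite mnmDE mnm1E in_cons.
case: eqP => [->|_]; first by rewrite (negbTE ls).
by case: (k \in s) => /=; rewrite ?add0n ?act_var_iter.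
Qed.

Lemma act_mulX k f p : comm_ideal f -> act x f ('X_k * p) = act_var x k (act x f p).
Proof.
move=> If; apply: (linear_mpolyP (f := act x f \o ('X_k \*o idfun))
  (g := act_var x k \o act x f) _ p) => m /=.
by rewrite -mpolyXD !actX act_mon_var.
Qed.

Lemma act_act_var k f p : comm_ideal f -> act x (act_var x k f) p = act x f ('X_k * p).
Proof.
move=> If; rewrite act_mulX //; apply: (linear_mpolyP (f := act x (act_var x k f))
  (g := act_var x k \o act x f) _ p) => m /=.
by rewrite !actX act_var_act_mon.
Qed.

Lemma actBl f g p : act x (f - g) p = act x f p - act x g p.
Proof.
rewrite /act -sumrB; apply: eq_bigr => m _; rewrite -scalerBr; congr (_ *: _).
rewrite /act_mon; elim: (enum _) => //= k s ->.
by elim: (m k) => //= i ->; rewrite linearB.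
Qed.

End ActTheory.

(** * Fox derivatives of the free algebra and their descent to F_n *)

Section FreeFox.
Import monalg mpoly.
Variables (K : fieldType) (n : nat).
Notation u i := ('X_(lshift n i) : polyUV K n).
Notation v i := ('X_(rshift n i) : polyUV K n).
Implicit Types (a b : freeA K n) (f g : FM K n).

Lemma freeA_ind (P : freeA K n -> Prop) :
  P 1 -> (forall a b, P a -> P b -> P (a + b)) ->
  (forall c a, P a -> P (c *: a)) ->
  (forall j a, P a -> P (<< fmu j >> * a)) -> forall a, P a.
Proof.
move=> P1 PD PZ PM a; rewrite (monalgE a).
apply: big_ind => [||w _]; first by rewrite -(scale0r 1); apply: PZ.
  exact: PD.
have -> c : << c *g w >> = c *: << w >> :> freeA K n.
  by apply/malgP => w'; rewrite monalg.mcoeffZ !monalg.mcoeffU mulrnAr mulr1.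
apply: (PZ); case: w => s; elim: s => [|j s IH].
  by have -> : FMonom [::] = mone :> {fmonom 'I_n} by apply: val_inj; rewrite /= fm1.
have -> : << FMonom (j :: s) >> = << fmu j >> * << FMonom s >> :> freeA K n.
  rewrite malgM_def fgmulUU mulr1; congr mkmalgU.
  by apply: val_inj; rewrite /= fmM fmU.
exact: PM.
Qed.

(* The Fox derivative of F_n with respect to x_i takes its values in K[U,V], a
   bimodule on which x_j acts as u_j on the left and as u_j + v_j on the right. *)
Definition freeL : freeA K n -> polyUV K n := free_eval (fun j => u j).
Definition freeR : freeA K n -> polyUV K n := free_eval (fun j => u j + v j).
HB.instance Definition _ := GRing.LRMorphism.on freeL.
HB.instance Definition _ := GRing.LRMorphism.on freeR.

(** A sum over the occurrences of x_i in the word: the letters x_k before the occurrence become u_k,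
    those after it u_k + v_k. *)
Definition word_fox (i : 'I_n) : seq 'I_n -> polyUV K n :=
  fix loop w := if w is j :: w' then
    (i == j)%:R * \prod_(k <- w') (u k + v k) + u j * loop w' else 0.

Definition free_fox (i : 'I_n) : freeA K n -> polyUV K n :=
  monalg.mmap (@mpolyC (n + n) K) (fun w : {fmonom 'I_n} => word_fox i w).
HB.instance Definition _ i := GRing.Additive.on (free_fox i).

Fact free_fox_scalable i : scalable (free_fox i).
Proof.
move=> c a; rewrite /free_fox (monalg.mmapEw (monalg.msuppZ_le _ _)).
rewrite /monalg.mmap scaler_sumr; apply: eq_bigr => w _.
by rewrite monalg.mcoeffZ /= mpolyCM -mulrA mul_mpolyC.
Qed.
HB.instance Definition _ i := GRing.isScalable.Build K (freeA K n)
  (polyUV K n) _ (free_fox i) (free_fox_scalable i).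

Lemma free_fox1 i : free_fox i 1 = 0.
Proof. by rewrite /free_fox monalg.mmapU fm1 mulr0. Qed.

Lemma free_fox_genM i j a : free_fox i (<< fmu j >> * a) =
  (i == j)%:R * freeR a + u j * free_fox i a.
Proof.
rewrite (monalgE a) mulr_sumr !linear_sum !mulr_sumr -big_split.
apply: eq_bigr => w _ /=.
rewrite malgM_def fgmulUU mul1r /free_fox /freeR /free_eval !monalg.mmapU fmM fmU /=.
by rewrite mulrDr !mulr_algl mul_mpolyC scalerAr mulrCA.
Qed.

Lemma freeLZ c a : freeL (c *: a) = c *: freeL a. Proof. exact: linearZ. Qed.
Lemma freeLD a b : freeL (a + b) = freeL a + freeL b. Proof. exact: raddfD. Qed.
Lemma freeLM a b : freeL (a * b) = freeL a * freeL b. Proof. exact: rmorphM. Qed.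
Lemma freeRM a b : freeR (a * b) = freeR a * freeR b. Proof. exact: rmorphM. Qed.
Lemma free_foxZ i c a : free_fox i (c *: a) = c *: free_fox i a.
Proof. exact: free_fox_scalable. Qed.
Lemma free_foxD i a b : free_fox i (a + b) = free_fox i a + free_fox i b.
Proof. exact: raddfD. Qed.

Lemma freeL_gen j : freeL << fmu j >> = u j. Proof. exact: free_eval_gen. Qed.
Lemma freeR_gen j : freeR << fmu j >> = u j + v j. Proof. exact: free_eval_gen. Qed.

(** The product rule of a derivation into the bimodule, by induction on the left factor because
    [word_fox] removes letters from the left. *)
Lemma free_foxM i a b :
  free_fox i (a * b) = freeL a * free_fox i b + free_fox i a * freeR b.
Proof.
elim/freeA_ind: a => [|a1 a2 IH1 IH2|c a IH|j a IH].
- by rewrite mul1r rmorph1 mul1r free_fox1 mul0r addr0.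
- rewrite (mulrDl a1 a2 b) !free_foxD freeLD.
  apply: (etrans (congr2 +%R IH1 IH2)).
  by rewrite (mulrDl (freeL a1)) (mulrDl (free_fox i a1)) addrACA.
- transitivity (c *: free_fox i (a * b)).
    by rewrite -(scalerAl c a b); apply: free_foxZ.
  rewrite IH freeLZ (free_foxZ i c a) scalerDr.
  by rewrite (scalerAl c (freeL a)) (scalerAl c (free_fox i a)).
transitivity ((i == j)%:R * (freeR a * freeR b) +
              u j * (freeL a * free_fox i b + free_fox i a * freeR b)).
  rewrite -(mulrA << fmu j >> a b); apply: (etrans (free_fox_genM i j (a * b))).
  by congr (_ * _ + _ * _); [apply: freeRM | apply: IH].
transitivity (u j * freeL a * free_fox i b +
              ((i == j)%:R * freeR a + u j * free_fox i a) * freeR b).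
  rewrite (mulrDr (u j)) (mulrDl _ (u j * free_fox i a)) addrCA.
  by rewrite (mulrA (u j)) (mulrA (u j)) (mulrA _ (freeR a)).
by rewrite freeLM freeL_gen; congr (_ + _ * _); apply/esym/free_fox_genM.
Qed.

Lemma comm_ideal_com (C : comNzRingType) (c : C) : comm_ideal c -> c = 0.
Proof.
move=> [m [x [s [y [Ss ->]]]]]; rewrite big1 // => i _.
by have [p [q ->]] := Ss i; rewrite [q * p]mulrC subrr mulr0 mul0r.
Qed.

Lemma freeL_comm a : comm_ideal a -> freeL a = 0.
Proof. by move=> Ia; apply/comm_ideal_com/comm_ideal_morph. Qed.

Lemma freeR_comm a : comm_ideal a -> freeR a = 0.
Proof. by move=> Ia; apply/comm_ideal_com/comm_ideal_morph. Qed.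

(** [freeL] and [freeR] kill commutators, their target being commutative. In the derivative of g h
    with g, h in the commutator ideal, each term contains the factor [freeL g] or [freeR h]. *)
Lemma metab_rel_kill a : metab_rel a ->
  [/\ freeL a = 0, freeR a = 0 & forall i, free_fox i a = 0].
Proof.
move=> [m [x [s [y [Ss ->]]]]].
have s0 j : [/\ freeL (s j) = 0, freeR (s j) = 0 & forall i, free_fox i (s j) = 0].
  have [g [h [Ig [Ih ->]]]] := Ss j; rewrite !rmorphM /=.
  rewrite (freeL_comm Ig) (freeR_comm Ig) !mul0r; split=> // i.
  by rewrite free_foxM (freeL_comm Ig) (freeR_comm Ih) mul0r mulr0 addr0.
split=> [||i]; rewrite linear_sum big1 // => j _; have [l0 r0 f0] := s0 j.
- by rewrite !rmorphM /= l0 mulr0 mul0r.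
- by rewrite !rmorphM /= r0 mulr0 mul0r.
by rewrite /= !free_foxM rmorphM /= l0 f0 r0 !mulr0 ?mul0r ?add0r ?addr0 ?mulr0 ?mul0r.
Qed.

Lemma free_fox_gen i j : free_fox i << fmu j >> = (i == j)%:R.
Proof.
by rewrite -[<< _ >>]mulr1 free_fox_genM rmorph1 free_fox1 mulr1 mulr0 addr0.
Qed.

Lemma FM_ind (P : FM K n -> Prop) :
  P 1 -> (forall f g, P f -> P g -> P (f + g)) ->
  (forall c f, P f -> P (c *: f)) ->
  (forall j f, P f -> P (FMgen K j * f)) -> forall f, P f.
Proof.
move=> P1 PD PZ PM f; rewrite -[f]FMpi_repr; elim/freeA_ind: (repr f).
- by rewrite rmorph1.
- by move=> a b Pa Pb; rewrite linearD; apply: PD.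
- by move=> c a Pa; rewrite linearZ; apply: PZ.
- by move=> j a Pa; rewrite rmorphM; apply: PM.
Qed.

Definition FMfoxL f := freeL (repr f).
Definition FMfoxR f := freeR (repr f).
Definition FMfox i f := free_fox i (repr f).

(** The values do not depend on the representative chosen by [repr]. *)
Lemma repr_FMpi a :
  [/\ FMfoxL (FMpi a) = freeL a, FMfoxR (FMpi a) = freeR a
    & forall i, FMfox i (FMpi a) = free_fox i a].
Proof.
have /metab_rel_kill[] : metab_rel (repr (FMpi a) - a).
  by apply/FMpiP; rewrite FMpi_repr.
rewrite !linearB => /subr0_eq ? /subr0_eq ? D0; split=> // i.
by apply/subr0_eq; have := D0 i; rewrite linearB.
Qed.

Lemma FMfoxL_pi a : FMfoxL (FMpi a) = freeL a. Proof. by case: (repr_FMpi a). Qed.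
Lemma FMfoxR_pi a : FMfoxR (FMpi a) = freeR a. Proof. by case: (repr_FMpi a). Qed.
Lemma FMfox_pi i a : FMfox i (FMpi a) = free_fox i a. Proof. by case: (repr_FMpi a). Qed.

Fact FMfoxL_is_linear : linear FMfoxL.
Proof.
by move=> c f g; rewrite -[f]FMpi_repr -[g]FMpi_repr -linearP !FMfoxL_pi linearP.
Qed.
Fact FMfoxR_is_linear : linear FMfoxR.
Proof.
by move=> c f g; rewrite -[f]FMpi_repr -[g]FMpi_repr -linearP !FMfoxR_pi linearP.
Qed.
Fact FMfox_is_linear i : linear (FMfox i).
Proof.
by move=> c f g; rewrite -[f]FMpi_repr -[g]FMpi_repr -linearP !FMfox_pi linearP.
Qed.

Fact FMfoxL_monoid : monoid_morphism FMfoxL.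
Proof.
split=> [|f g]; first by rewrite -(rmorph1 (@FMpi K n)) FMfoxL_pi rmorph1.
by rewrite -[f]FMpi_repr -[g]FMpi_repr -rmorphM !FMfoxL_pi rmorphM.
Qed.
Fact FMfoxR_monoid : monoid_morphism FMfoxR.
Proof.
split=> [|f g]; first by rewrite -(rmorph1 (@FMpi K n)) FMfoxR_pi rmorph1.
by rewrite -[f]FMpi_repr -[g]FMpi_repr -rmorphM !FMfoxR_pi rmorphM.
Qed.

Lemma FMfoxM i f g : FMfox i (f * g) = FMfoxL f * FMfox i g + FMfox i f * FMfoxR g.
Proof.
by rewrite -[f]FMpi_repr -[g]FMpi_repr -rmorphM !FMfox_pi FMfoxL_pi FMfoxR_pi free_foxM.
Qed.

Lemma FMfoxL_gen j : FMfoxL (FMgen K j) = u j.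
Proof. by rewrite FMfoxL_pi freeL_gen. Qed.

Lemma FMfoxR_gen j : FMfoxR (FMgen K j) = u j + v j.
Proof. by rewrite FMfoxR_pi freeR_gen. Qed.

Lemma FMfox_gen i j : FMfox i (FMgen K j) = (i == j)%:R.
Proof.
by rewrite FMfox_pi free_fox_gen.
Qed.

End FreeFox.

Section FoxInstances.
Variables (K : fieldType) (n : nat).
HB.instance Definition _ :=
  GRing.isLinear.Build K (FM K n) (polyUV K n) _ (@FMfoxL K n)
    (@FMfoxL_is_linear K n).
HB.instance Definition _ :=
  GRing.isLinear.Build K (FM K n) (polyUV K n) _ (@FMfoxR K n)
    (@FMfoxR_is_linear K n).
HB.instance Definition _ i :=
  GRing.isLinear.Build K (FM K n) (polyUV K n) _ (@FMfox K n i)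
    (@FMfox_is_linear K n i).
HB.instance Definition _ :=
  GRing.isMonoidMorphism.Build (FM K n) (polyUV K n) (@FMfoxL K n)
    (@FMfoxL_monoid K n).
HB.instance Definition _ :=
  GRing.isMonoidMorphism.Build (FM K n) (polyUV K n) (@FMfoxR K n)
    (@FMfoxR_monoid K n).
End FoxInstances.

(** The properties of F_n through which the rest of the argument sees it: induction on generators,
    the metabelian identity and the Fox derivatives. The quotient construction stays hidden behind
    them. *)
Record foxAlg (K : fieldType) (n : nat) := FoxAlg {
  fox_alg :> algType K;
  fox_x : 'I_n -> fox_alg;
  fox_alg_ind : forall P : fox_alg -> Prop,
    P 1 -> (forall f g, P f -> P g -> P (f + g)) ->
    (forall c f, P f -> P (c *: f)) ->
    (forall j f, P f -> P (fox_x j * f)) -> forall f, P f;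
  fox_metab : forall f g : fox_alg, comm_ideal f -> comm_ideal g -> f * g = 0;
  foxL : {lrmorphism fox_alg -> polyUV K n};
  foxR : {lrmorphism fox_alg -> polyUV K n};
  fox : 'I_n -> {linear fox_alg -> polyUV K n};
  foxL_x : forall j, foxL (fox_x j) = 'X_(lshift n j);
  foxR_x : forall j, foxR (fox_x j) = 'X_(lshift n j) + 'X_(rshift n j);
  fox_xE : forall i j, fox i (fox_x j) = (i == j)%:R;
  foxM : forall i f g, fox i (f * g) = foxL f * fox i g + fox i f * foxR g
}.

Definition FM_foxAlg (K : fieldType) (n : nat) : foxAlg K n :=
  @FoxAlg K n (FM K n) (@FMgen K n) (@FM_ind K n) (@FM_metabelian K n)
    (@FMfoxL K n) (@FMfoxR K n) (@FMfox K n)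
    (@FMfoxL_gen K n) (@FMfoxR_gen K n) (@FMfox_gen K n) (@FMfoxM K n).

(** * Fox derivatives as coordinates on the commutator ideal: exactness of the Koszul complex *)

Section KoszulInverse.
Variables (K : fieldType) (n : nat) (A : foxAlg K n).
Implicit Types (f g : A) (p r : polyUV K n).
Notation x := (@fox_x K n A).
Notation v i := ('X_(rshift n i) : polyUV K n).
Notation dv i p := (mderiv (rshift n i) p).
Notation br i j := (x i * x j - x j * x i).

Lemma br_comm_ideal i j : comm_ideal (br i j).
Proof. exact: comm_ideal_comm. Qed.

Lemma fox_act_mulX k f p :
  comm_ideal f -> act x f ('X_k * p) = act_var x k (act x f p).
Proof. by apply: act_mulX; apply: fox_metab. Qed.

Lemma fox_act_act_var k f p :
  comm_ideal f -> act x (act_var x k f) p = act x f ('X_k * p).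
Proof. by apply: act_act_var; apply: fox_metab. Qed.

Lemma act_var_l j f : act_var x (lshift n j) f = x j * f.
Proof. by rewrite /act_var split_lshift. Qed.

Lemma act_var_r j f : act_var x (rshift n j) f = f * x j - x j * f.
Proof. by rewrite /act_var split_rshift. Qed.

Lemma fox1 i : fox A i 1 = 0.
Proof.
have := foxM i (1 : A) 1; rewrite mulr1 !rmorph1 mul1r mulr1.
by move/eqP; rewrite -subr_eq subrr => /eqP <-.
Qed.

Lemma foxL_comm_ideal f : comm_ideal f -> foxL A f = 0.
Proof. by move=> If; apply/comm_ideal_com/comm_ideal_morph. Qed.

Lemma foxR_comm_ideal f : comm_ideal f -> foxR A f = 0.
Proof. by move=> If; apply/comm_ideal_com/comm_ideal_morph. Qed.

Lemma fox_xMl i j f : comm_ideal f -> fox A i (x j * f) = 'X_(lshift n j) * fox A i f.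
Proof. by move=> If; rewrite foxM foxL_x (foxR_comm_ideal If) mulr0 addr0. Qed.

Lemma fox_xMr i j f : comm_ideal f ->
  fox A i (f * x j) = ('X_(lshift n j) + v j) * fox A i f.
Proof.
by move=> If; rewrite foxM foxR_x (foxL_comm_ideal If) mul0r add0r mulrC.
Qed.

Lemma fox_act_var i k f : comm_ideal f -> fox A i (act_var x k f) = 'X_k * fox A i f.
Proof.
move=> If; case: (split_ordP k) => j ->.
  by rewrite act_var_l fox_xMl.
by rewrite act_var_r linearB /= fox_xMl // fox_xMr // mulrDl addrAC subrr add0r.
Qed.

Lemma fox_act i f p : comm_ideal f -> fox A i (act x f p) = p * fox A i f.
Proof.
move=> If; apply: (linear_mpolyP (f := fox A i \o act x f)
  (g := fox A i f \o* idfun) _ p) => m /=.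
rewrite actX (act_mon_eigen (e := fun k => 'X_k)) ?mmap1_id //.
exact: fox_act_var.
Qed.

Lemma fox_br i j k :
  fox A i (br j k) = (i == j)%:R * v k - (i == k)%:R * v j.
Proof.
by rewrite linearB /= !foxM !foxL_x !foxR_x !fox_xE; ring.
Qed.

Definition br_span f := exists P : 'I_n -> 'I_n -> polyUV K n,
  f = \sum_i \sum_j act x (br i j) (P i j).

Lemma br_spanD f g : br_span f -> br_span g -> br_span (f + g).
Proof.
move=> [P ->] [Q ->]; exists (fun i j => P i j + Q i j).
rewrite -big_split; apply: eq_bigr => i _; rewrite -big_split.
by apply: eq_bigr => j _ /=; rewrite linearD.
Qed.

Lemma br_spanZ c f : br_span f -> br_span (c *: f).
Proof.
move=> [P ->]; exists (fun i j => c *: P i j).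
rewrite scaler_sumr; apply: eq_bigr => i _; rewrite scaler_sumr.
by apply: eq_bigr => j _; rewrite linearZ.
Qed.

Lemma br_span0 : br_span 0.
Proof.
exists (fun _ _ => 0); rewrite big1 // => i _; rewrite big1 // => j _.
by rewrite linear0.
Qed.

Lemma br_span_act_var k f : br_span f -> br_span (act_var x k f).
Proof.
move=> [P ->]; exists (fun i j => 'X_k * P i j).
rewrite linear_sum; apply: eq_bigr => i _; rewrite linear_sum.
by apply: eq_bigr => j _; rewrite fox_act_mulX //; apply: br_comm_ideal.
Qed.

Lemma br_span_gen i j : br_span (br i j).
Proof.
exists (fun k l => if (k == i) && (l == j) then 1 else 0).
rewrite (sum_delta_l (i := i)) => [|k /negbTE ki].
  rewrite (sum_delta_l (i := j)) => [|l /negbTE lj]; first by rewrite !eqxx act1.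
  by rewrite lj andbF linear0.
by rewrite big1 // => l _; rewrite ki linear0.
Qed.

Lemma br_span_genMl j f : br_span f -> br_span (x j * f).
Proof. by rewrite -act_var_l; apply: br_span_act_var. Qed.

Lemma br_span_genMr j f : br_span f -> br_span (f * x j).
Proof.
move=> Sf; have -> : f * x j = act_var x (rshift n j) f + act_var x (lshift n j) f.
  by rewrite act_var_r act_var_l subrK.
by apply: br_spanD; apply: br_span_act_var.
Qed.

Lemma br_spanMl g f : br_span f -> br_span (g * f).
Proof.
move=> Sf; elim/fox_alg_ind: g => [|g h Sg Sh|c g Sg|j g Sg].
- by rewrite mul1r.
- by rewrite mulrDl; apply: br_spanD.
- by rewrite -scalerAl; apply: br_spanZ.
by rewrite -mulrA; apply: br_span_genMl.
Qed.

Lemma br_spanMr g f : br_span f -> br_span (f * g).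
Proof.
elim/fox_alg_ind: g f => [|g h Sg Sh|c g Sg|j g Sg] f Sf.
- by rewrite mulr1.
- by rewrite mulrDr; apply: br_spanD; [apply: Sg | apply: Sh].
- by rewrite -scalerAr; apply/br_spanZ/Sg.
by rewrite mulrA; apply/Sg/br_span_genMr.
Qed.

(** Induction through [x_j, x_k g] = [x_j, x_k] g + x_k [x_j, g]. *)
Lemma br_span_genC j g : br_span (x j * g - g * x j).
Proof.
elim/fox_alg_ind: g => [|g h Sg Sh|c g Sg|k g Sg].
- by rewrite mulr1 mul1r subrr; apply: br_span0.
- by rewrite mulrDr mulrDl opprD addrACA; apply: br_spanD.
- by rewrite -scalerAr -scalerAl -scalerBr; apply: br_spanZ.
have -> : x j * (x k * g) - x k * g * x j = br j k * g + x k * (x j * g - g * x j).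
  by rewrite mulrBl mulrBr !mulrA addrA subrK.
by apply: br_spanD; [apply/br_spanMr/br_span_gen | apply: br_spanMl].
Qed.

Lemma br_span_comm f g : br_span (f * g - g * f).
Proof.
elim/fox_alg_ind: f => [|f h Sf Sh|c f Sf|k f Sf].
- by rewrite mulr1 mul1r subrr; apply: br_span0.
- by rewrite mulrDr mulrDl opprD addrACA; apply: br_spanD.
- by rewrite -scalerAr -scalerAl -scalerBr; apply: br_spanZ.
have -> : x k * f * g - g * (x k * f) = x k * (f * g - g * f) + (x k * g - g * x k) * f.
  by rewrite mulrBl mulrBr !mulrA addrA subrK.
by apply: br_spanD; [apply: br_spanMl | apply/br_spanMr/br_span_genC].
Qed.

(** The span of the brackets under the action is a two-sided ideal, because left multiplication by
    x_j is the action of u_j and right multiplication that of u_j + v_j; it contains all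
    commutators. *)
Lemma comm_ideal_span f : comm_ideal f -> br_span f.
Proof.
move=> [m [a [s [b [Ss ->]]]]]; apply: big_ind => [||i _]; first exact: br_span0.
  exact: br_spanD.
by have [c [d ->]] := Ss i; apply/br_spanMr/br_spanMl/br_span_comm.
Qed.

(* The maps f |-> (fox A i f)_i and h |-> koszul_inv h are mutually inverse
   between F' and the h with \sum_i v_i h_i = 0: this is the exactness of the
   Koszul complex of v_1, ..., v_n, with the usual contracting homotopy. *)
Definition koszul_inv (h : 'I_n -> polyUV K n) : A :=
  \sum_i \sum_l act x (br i l) (dv l (vEuler_inv 1 (h i))).

Hypothesis charK : [pchar K] =i pred0.

Lemma koszul_inv_comm_ideal h : comm_ideal (koszul_inv h).
Proof.
by do 2!apply: comm_ideal_sum => ? _; apply/act_comm_ideal/br_comm_ideal.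
Qed.

(** By linearity it suffices to treat [x_a, x_b], where the sum is v_a v_b - v_b v_a. *)
Lemma fox_koszul f : comm_ideal f -> \sum_i v i * fox A i f = 0.
Proof.
move=> /comm_ideal_span[P ->].
transitivity (\sum_i \sum_a \sum_b
    v i * (P a b * ((i == a)%:R * v b - (i == b)%:R * v a))).
  apply: eq_bigr => i _; rewrite linear_sum mulr_sumr; apply: eq_bigr => a _.
  rewrite linear_sum mulr_sumr; apply: eq_bigr => b _.
  by rewrite fox_act ?fox_br //; apply: br_comm_ideal.
rewrite exchange_big big1 // => a _; rewrite exchange_big big1 // => b _ /=.
under eq_bigr => i _ do rewrite mulrCA.
rewrite -mulr_sumr (_ : \sum_i _ = 0) ?mulr0 //.
under eq_bigr => i _ do rewrite mulrBr.
rewrite sumrB (sum_delta_l (i := a)) => [|j /negbTE ->]; last by rewrite mul0r mulr0.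
rewrite (sum_delta_l (i := b)) => [|j /negbTE ->]; last by rewrite mul0r mulr0.
by rewrite !eqxx !mul1r mulrC subrr.
Qed.

(** For h' = (E + 1)^-1 h the derivative to be computed is E h'_i minus the sum of the v_j
    dh'_j/dv_i. Differentiating the relation between the h'_j with respect to v_i shows that this
    sum is -h'_i, and E h'_i + h'_i = h_i. *)
Lemma fox_koszul_inv h i :
  \sum_j v j * h j = 0 -> fox A i (koszul_inv h) = h i.
Proof.
move=> h0; set h' := fun j => vEuler_inv 1 (h j).
(* Moving v_j inside turns c = 1 into c = 0, the same operator for all j, which is then applied to
   the given relation. *)
have h'0 : \sum_j v j * h' j = 0.
  under eq_bigr => j _ do rewrite -vEuler_inv_var.
  by rewrite -linear_sum h0 linear0.
have dh' : h' i + \sum_j v j * dv i (h' j) = 0.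
  have := congr1 (mderiv (rshift n i)) h'0; rewrite linear0 linear_sum /= => d0.
  apply: etrans d0.
  under [RHS]eq_bigr => j _ do rewrite mderivM.
  rewrite big_split /=; congr (_ + _).
  rewrite (sum_delta_l (i := i)) ?mderivXU ?eqxx ?mul1r // => j ji.
  by rewrite mderivXU (inj_eq (@rshift_inj _ _)) (negbTE ji) mul0r.
transitivity (\sum_a (\sum_l dv l (h' a) * ((i == a)%:R * v l) -
                      \sum_l dv l (h' a) * ((i == l)%:R * v a))).
  rewrite /koszul_inv linear_sum; apply: eq_bigr => a _; rewrite linear_sum -sumrB.
  apply: eq_bigr => l _; rewrite -mulrBr.
  by rewrite fox_act ?fox_br //; apply: br_comm_ideal.
rewrite sumrB (sum_delta_l (i := i)) => [|j ji]; last first.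
  by rewrite big1 // => l _; rewrite eq_sym (negbTE ji) mul0r mulr0.
have -> : \sum_(l < n) dv l (h' i) * ((i == i)%:R * v l) = vEuler (h' i).
  by apply: eq_bigr => l _; rewrite eqxx mul1r mulrC.
have -> : \sum_(a < n) \sum_(l < n) dv l (h' a) * ((i == l)%:R * v a) =
          \sum_j v j * dv i (h' j).
  apply: eq_bigr => a _; rewrite (sum_delta_l (i := i)) => [|l li].
    by rewrite eqxx mul1r mulrC.
  by rewrite eq_sym (negbTE li) mul0r mulr0.
have -> : \sum_j v j * dv i (h' j) = - h' i by apply/eqP; rewrite -addr_eq0 addrC dh'.
by rewrite opprK -{2}[h' i]scale1r; apply: (vEuler_invK charK (c := 1)).
Qed.

(** The Jacobi identity, v_j acting as the commutator with x_j on the right. *)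
Lemma br_jacobi a b l :
  act_var x (rshift n b) (br a l) - act_var x (rshift n a) (br b l) =
  act_var x (rshift n l) (br a b).
Proof.
(* The six words of length three in the expansion are abstracted to elements of an abelian group. *)
have E (V : zmodType) (P B C D L M : V) :
    P - L - (B - C) - (C - M - (D - P)) = D - B - (L - M).
  rewrite !opprB addrACA [P - L + _]addrC subrKA [C - B + _]addrC subrKA.
  by rewrite addrACA [- L + _]addrC [RHS]addrACA.
by rewrite !act_var_r !mulrBl !mulrBr !mulrA E.
Qed.

Fact koszul_inv_fox_linear : linear (fun f => koszul_inv (fun i => fox A i f)).
Proof.
move=> c f g; rewrite /koszul_inv scaler_sumr -big_split; apply: eq_bigr => i _.
rewrite scaler_sumr -big_split; apply: eq_bigr => j _ /=.
by rewrite !linearP.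
Qed.

(** With r = (E + 2)^-1 p, the factors v_b and v_a of the derivatives contribute 2r when
    differentiated, the remaining terms combine to E r by the Jacobi identity, and E r + 2r = p. *)
Lemma koszul_inv_fox_br a b p :
  koszul_inv (fun i => fox A i (act x (br a b) p)) = act x (br a b) p.
Proof.
(* The constant 2 is the 1 of [koszul_inv] raised by the factor v_a or v_b of the derivatives. *)
have bc := br_comm_ideal; pose r := vEuler_inv 2 p.
have fE i : vEuler_inv 1 (fox A i (act x (br a b) p)) =
    (i == a)%:R * (v b * r) - (i == b)%:R * (v a * r).
  rewrite fox_act // fox_br mulrBr linearB /=.
  have E c (e : bool) : vEuler_inv 1 (p * (e%:R * v c)) = e%:R * (v c * r).
    case: e; last by rewrite !mul0r mulr0 linear0.
    by rewrite !mul1r mulrC vEuler_inv_var.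
  by rewrite !E.
pose G i (y : polyUV K n) := \sum_l act x (br i l) (dv l y).
have G0 i : G i 0 = 0 by rewrite /G big1 // => l _; rewrite !linear0.
have GB i y z : G i (y - z) = G i y - G i z.
  by rewrite /G -sumrB; apply: eq_bigr => l _; rewrite !linearB.
have -> : koszul_inv (fun i => fox A i (act x (br a b) p)) =
          G a (v b * r) - G b (v a * r).
  rewrite /koszul_inv; under eq_bigr => i _ do under eq_bigr => l _ do rewrite fE.
  have -> : \sum_(i < n) G i ((i == a)%:R * (v b * r) - (i == b)%:R * (v a * r)) =
    \sum_(i < n) (G i ((i == a)%:R * (v b * r)) - G i ((i == b)%:R * (v a * r))).
    by apply: eq_bigr => i _; rewrite GB.
  rewrite sumrB (sum_delta_l (i := a)) => [|j /negbTE ->]; last by rewrite mul0r G0.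
  rewrite (sum_delta_l (i := b)) => [|j /negbTE ->]; last by rewrite mul0r G0.
  by rewrite !eqxx !mul1r.
have GE c d : G c (v d * r) =
    act x (br c d) r + \sum_l act x (br c l) (v d * dv l r).
  rewrite /G; under eq_bigr => l _ do rewrite mderivM linearD /=.
  rewrite big_split /=; congr (_ + _); rewrite (sum_delta_l (i := d)).
    by rewrite mderivXU eqxx mul1r.
  move=> l ld; rewrite mderivXU (inj_eq (@rshift_inj _ _)) eq_sym (negbTE ld).
  by rewrite mul0r linear0.
rewrite !GE opprD addrACA.
have -> : \sum_l act x (br a l) (v b * dv l r) - \sum_l act x (br b l) (v a * dv l r) =
          act x (br a b) (vEuler r).
  rewrite -sumrB linear_sum; apply: eq_bigr => l _.
  by rewrite /= -!fox_act_act_var // -actBl br_jacobi.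
have -> : act x (br a b) r - act x (br b a) r = act x (br a b) (2%:R *: r).
  rewrite scaler_nat mulr2n linearD /=; congr (_ + _).
  have -> : br b a = 0 - br a b by rewrite sub0r opprB.
  by rewrite actBl -[0](subrr 0) actBl subrr sub0r opprK.
by rewrite -linearD -[p in RHS](vEuler_invK charK (isT : (0 < 2)%N)) [X in _ = act _ _ X]addrC.
Qed.

Lemma koszul_inv_fox f : comm_ideal f -> koszul_inv (fun i => fox A i f) = f.
Proof.
move=> /comm_ideal_span[P ->].
pose L := GRing.isLinear.Build K _ _ _ _ koszul_inv_fox_linear.
pose F : {linear A -> A} := HB.pack (fun f => koszul_inv (fun i => fox A i f)) L.
rewrite -[LHS]/(F _) linear_sum; apply: eq_bigr => i _.
rewrite linear_sum; apply: eq_bigr => j _; exact: koszul_inv_fox_br.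
Qed.

Lemma fox_inj f g : comm_ideal f -> comm_ideal g ->
  (forall i, fox A i f = fox A i g) -> f = g.
Proof.
move=> If Ig fg; rewrite -(koszul_inv_fox If) -(koszul_inv_fox Ig).
by apply: eq_bigr => i _; rewrite fg.
Qed.

End KoszulInverse.

(** * Compatibility of a derivation of F_n with Fox derivatives *)

Section DerivationFox.
Variables (K : fieldType) (n : nat) (A : foxAlg K n).
Variables (delta : {linear A -> A}) (alpha : 'M[K]_n).
Hypothesis deltaM : forall f g, delta (f * g) = delta f * g + f * delta g.
Hypothesis delta_x :
  forall j, delta (fox_x A j) = \sum_(i < n) alpha i j *: fox_x A i.

Lemma delta1 : delta 1 = 0.
Proof.
have := deltaM 1 1; rewrite !mulr1 mul1r.
by move/eqP; rewrite -subr_eq subrr => /eqP <-.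
Qed.

Lemma foxL_delta f : foxL A (delta f) = polyD alpha (foxL A f).
Proof.
elim/fox_alg_ind: f => [|f g IHf IHg|c f IH|j f IH].
- by rewrite delta1 linear0 rmorph1 -mpolyC1 polyDC.
- by rewrite !linearD /= IHf IHg.
- by rewrite !linearZ /= IH.
rewrite deltaM linearD !rmorphM /= IH polyDM foxL_x; congr (_ * _ + _).
rewrite delta_x linear_sum polyD_u; apply: eq_bigr => i _.
by rewrite linearZ /= foxL_x.
Qed.

Lemma foxR_delta f : foxR A (delta f) = polyD alpha (foxR A f).
Proof.
elim/fox_alg_ind: f => [|f g IHf IHg|c f IH|j f IH].
- by rewrite delta1 linear0 rmorph1 -mpolyC1 polyDC.
- by rewrite !linearD /= IHf IHg.
- by rewrite !linearZ /= IH.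
rewrite deltaM linearD !rmorphM /= IH polyDM foxR_x; congr (_ * _ + _).
rewrite delta_x linear_sum linearD /= polyD_u polyD_v -big_split.
by apply: eq_bigr => i _; rewrite linearZ /= foxR_x scalerDr.
Qed.

Lemma fox_delta_x i j : fox A i (delta (fox_x A j)) = (alpha i j)%:MP.
Proof.
rewrite delta_x linear_sum (sum_delta_l (i := i)) => [|k ki].
  by rewrite linearZ /= fox_xE eqxx -[1]/(1%:MP) -mul_mpolyC mulr1.
by rewrite linearZ /= fox_xE eq_sym (negbTE ki) scaler0.
Qed.

(** The difference between [fox i] of [delta f] and D of [fox i f], as well as the sum on the right,
    are derivations into the bimodule; both take the value alpha_ij on x_j. *)
Lemma fox_delta i f : fox A i (delta f) =
  polyD alpha (fox A i f) + \sum_j alpha i j *: fox A j f.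
Proof.
elim/fox_alg_ind: f => [|f g IHf IHg|c f IH|j f IH].
- rewrite delta1 linear0 fox1 linear0 big1 ?addr0 // => j _.
  by rewrite fox1 scaler0.
- rewrite !linearD /= IHf IHg addrACA; congr (_ + _).
  by rewrite -big_split; apply: eq_bigr => j _; rewrite linearD scalerDr.
- rewrite !linearZ /= IH scalerDr; congr (_ + _); rewrite scaler_sumr.
  by apply: eq_bigr => j _; rewrite (linearZZ (fox A j)) !scalerA mulrC.
have -> : \sum_k alpha i k *: fox A k (fox_x A j * f) =
    foxL A (fox_x A j) * (\sum_k alpha i k *: fox A k f) + (alpha i j)%:MP * foxR A f.
  under eq_bigr => k _ do rewrite foxM fox_xE scalerDr scalerAr.
  rewrite big_split /= -mulr_sumr [X in _ + X](sum_delta_l (i := j)) => [|k /negbTE kj].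
    by rewrite eqxx mul1r mul_mpolyC.
  by rewrite kj mul0r scaler0.
have dk (b : bool) : polyD alpha b%:R = 0 by rewrite -mpolyC_nat polyDC.
rewrite deltaM linearD /= !foxM foxL_delta foxR_delta IH fox_delta_x fox_xE.
rewrite linearD /= !polyDM dk mul0r add0r mulrDr.
set a := polyD _ (foxL _ _) * _; set b := _%:MP * _; set c := _ * polyD _ (fox _ _ _).
set d := _ * \sum__ _; set e := _ * polyD _ (foxR _ _).
by rewrite -!addrA; congr (_ + _); rewrite addrC -!addrA; congr (_ + _);
  rewrite addrCA; congr (_ + _).
Qed.

Lemma delta_comm_ideal f : comm_ideal f -> comm_ideal (delta f).
Proof.
move=> [m [a [s [b [Ss ->]]]]]; rewrite linear_sum; apply: comm_ideal_sum => i _ /=.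
have Is : comm_ideal (s i) by apply: ideal_gen_sub.
have Ids : comm_ideal (delta (s i)).
  have [c [d ->]] := Ss i; rewrite linearB /= !deltaM.
  (* Regrouped as the sum of the commutators [delta c, d] and [c, delta d]. *)
  rewrite [delta d * c + _]addrC opprD addrACA.
  by apply: ideal_genD; apply: comm_ideal_comm.
rewrite !deltaM; apply: ideal_genD; last by apply: ideal_genM.
by rewrite mulrDl; apply: ideal_genD; apply: ideal_genM.
Qed.

End DerivationFox.

(** * Fox derivatives of F_{d-1} inside F_d and of the image of pi *)

Section EmbeddingFox.
Variables (K : fieldType) (n : nat) (A : foxAlg K n) (A' : foxAlg K n.+1).
Variable emb : {lrmorphism A -> A'}.
Hypothesis emb_x : forall i, emb (fox_x A i) = fox_x A' (widen1 i).
Notation vd := ('X_(rshift n.+1 ord_max) : polyUV K n.+1).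
Notation dv i p := (mderiv (rshift n i) p).

Lemma foxL_emb f : foxL A' (emb f) = poly_widen (foxL A f).
Proof.
elim/fox_alg_ind: f => [|f g IHf IHg|c f IH|j f IH].
- by rewrite !rmorph1.
- by rewrite !linearD /= IHf IHg.
- by rewrite !linearZ /= IH.
by rewrite !rmorphM /= IH emb_x !foxL_x poly_widenX uv_widenl.
Qed.

Lemma foxR_emb f : foxR A' (emb f) = poly_widen (foxR A f).
Proof.
elim/fox_alg_ind: f => [|f g IHf IHg|c f IH|j f IH].
- by rewrite !rmorph1.
- by rewrite !linearD /= IHf IHg.
- by rewrite !linearZ /= IH.
by rewrite !rmorphM /= IH emb_x !foxR_x rmorphD /= !poly_widenX uv_widenl uv_widenr.
Qed.

Lemma fox_emb i f : fox A' (widen1 i) (emb f) = poly_widen (fox A i f).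
Proof.
elim/fox_alg_ind: f => [|f g IHf IHg|c f IH|j f IH].
- by rewrite rmorph1 !fox1 linear0.
- by rewrite !linearD /= IHf IHg.
- by rewrite !linearZ /= IH.
rewrite rmorphM !foxM rmorphD !rmorphM /= IH -foxL_emb -foxR_emb emb_x !fox_xE.
by rewrite rmorph_nat (inj_eq (@widen1_inj _)).
Qed.

Lemma fox_emb_max f : fox A' ord_max (emb f) = 0.
Proof.
elim/fox_alg_ind: f => [|f g IHf IHg|c f IH|j f IH].
- by rewrite rmorph1 fox1.
- by rewrite !linearD /= IHf IHg addr0.
- by rewrite !linearZ /= IH scaler0.
by rewrite rmorphM foxM /= IH emb_x fox_xE eq_sym widen1_neq_max mulr0 mul0r addr0.
Qed.

Notation xw := (fun i => fox_x A' (widen1 i)).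
Notation brd j := (fox_x A' ord_max * xw j - xw j * fox_x A' ord_max).

Lemma fox_act_mon_xw i m f : comm_ideal f ->
  fox A' i (act_mon xw m f) = poly_widen 'X_[m] * fox A' i f.
Proof.
move=> If; rewrite (act_mon_eigen (e := fun k => poly_widen 'X_k)) //.
  congr (_ * _); rewrite /poly_widen comp_mpolyX; apply: eq_bigr => k _.
  by rewrite comp_mpolyXU -tnth_nth.
move=> k g Ig; rewrite /act_var poly_widenX; case: (split_ordP k) => j ->.
  by rewrite fox_xMl // uv_widenl.
by rewrite linearB /= fox_xMl // fox_xMr // mulrDl addrAC subrr add0r uv_widenr.
Qed.

(** [pi_mon] over an abstract [foxAlg]; the two are convertible on [FM_foxAlg]. *)
Definition fox_pi_mon (m : 'X_{1..n + n}) : A' :=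
  \sum_(j < n) act_mon xw (m - U_(rshift n j))%MM (brd j) *+ m (rshift n j).

Definition fox_pi : polyUV K n -> A' := mlin fox_pi_mon.
HB.instance Definition _ := GRing.Linear.on fox_pi.

Lemma fox_piX m : fox_pi 'X_[m] = fox_pi_mon m.
Proof. exact: mlinX. Qed.

Lemma fox_pi_comm_ideal p : comm_ideal (fox_pi p).
Proof.
apply: comm_ideal_sum => m _; apply/comm_idealZ/comm_ideal_sum => j _.
rewrite -mulr_natr; apply: ideal_genMr.
exact/act_mon_comm_ideal/comm_ideal_comm.
Qed.

(** The exponent of v_j in m times m / v_j is the partial derivative of m, so pi(p) is the sum over
    j of dp/dv_j applied to [x_d, x_j]. Where the exponent is 0, the truncated subtraction is
    multiplied by 0. *)
Lemma fox_fox_pi i p : fox A' i (fox_pi p) =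
  \sum_(j < n) poly_widen (dv j p) * fox A' i (brd j).
Proof.
have Ibr j : comm_ideal (brd j) by apply: comm_ideal_comm.
elim/mpolyind: p => [|c m p _ _ IH].
  by rewrite !linear0 big1 // => j _; rewrite !linear0 mul0r.
under [RHS]eq_bigr => j _ do rewrite linearD /= linearD mulrDl.
rewrite big_split /= -IH !linearD /=; congr (_ + _).
rewrite (linearZZ fox_pi) (linearZZ (fox A' i)) /= fox_piX linear_sum.
rewrite scaler_sumr; apply: eq_bigr => j _.
rewrite raddfMn /= fox_act_mon_xw // mderivZ mderivX !(linearZZ (@poly_widen K n)).
by rewrite -!scalerAl scaler_nat.
Qed.

Lemma fox_pi_max p : fox A' ord_max (fox_pi p) = poly_widen (vEuler p).
Proof.
rewrite fox_fox_pi rmorph_sum; apply: eq_bigr => j _ /=.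
rewrite fox_br eqxx eq_sym widen1_neq_max mul1r mul0r subr0.
by rewrite rmorphM /= poly_widenX uv_widenr mulrC.
Qed.

Lemma fox_pi_widen i p :
  fox A' (widen1 i) (fox_pi p) = - (vd * poly_widen (dv i p)).
Proof.
rewrite fox_fox_pi (sum_delta_l (i := i)) => [|j /negbTE ji].
  by rewrite fox_br widen1_neq_max eqxx mul0r mul1r sub0r mulrN mulrC.
rewrite fox_br widen1_neq_max (inj_eq (@widen1_inj _)) eq_sym ji.
by rewrite !mul0r subrr mulr0.
Qed.

End EmbeddingFox.

(** * Laws of the action, verified on Fox derivatives *)

Section ModuleLaws.
Variables (K : fieldType) (n : nat) (A : foxAlg K n).
Hypothesis charK : [pchar K] =i pred0.
Implicit Types (f : A) (p q : polyUV K n).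
Notation x := (@fox_x K n A).

Lemma act_act f p q : comm_ideal f -> act x (act x f p) q = act x f (p * q).
Proof.
move=> If; have Ip := act_comm_ideal x p If.
apply: (fox_inj charK) => [||i]; try exact: act_comm_ideal.
by rewrite !fox_act // mulrCA mulrA.
Qed.

Lemma act_suml (m : nat) (F : 'I_m -> A) p : (forall i, comm_ideal (F i)) ->
  act x (\sum_i F i) p = \sum_i act x (F i) p.
Proof.
move=> IF; have Is : comm_ideal (\sum_i F i) by apply: comm_ideal_sum.
apply: (fox_inj charK) => [||i]; first exact: act_comm_ideal.
  by apply: comm_ideal_sum => i _; apply: act_comm_ideal.
rewrite fox_act // !linear_sum mulr_sumr; apply: eq_bigr => j _.
by rewrite /= fox_act.
Qed.

Lemma act0 p : act x 0 p = 0.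
Proof. by have := actBl x 0 0 p; rewrite !subrr. Qed.

Lemma delta_act (delta : {linear A -> A}) (alpha : 'M[K]_n) f p :
  (forall f g, delta (f * g) = delta f * g + f * delta g) ->
  (forall j, delta (x j) = \sum_(i < n) alpha i j *: x i) ->
  comm_ideal f ->
  delta (act x f p) = act x (delta f) p + act x f (polyD alpha p).
Proof.
move=> dM dx If; have Idf := delta_comm_ideal dM If.
apply: (fox_inj charK) => [||i].
- exact/(delta_comm_ideal dM)/act_comm_ideal.
- by apply: ideal_genD; apply: act_comm_ideal.
rewrite (fox_delta dM dx) linearD /= !fox_act // (fox_delta dM dx) polyDM mulrDr.
rewrite addrAC [RHS]addrC -addrA; congr (_ + _).
rewrite addrC; congr (_ + _); rewrite mulr_sumr; apply: eq_bigr => j _.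
by rewrite fox_act // scalerAr.
Qed.

End ModuleLaws.

Lemma V_free_mderiv (K : fieldType) n (p : polyUV K n) j :
  V_free p -> p^`M(rshift n j) = 0.
Proof.
move=> Vp; rewrite /mderiv big_seq big1 // => m /Vp ->.
by rewrite mul0r scale0r.
Qed.

(** * Decomposition of the constants of F_d' and their generation *)

Section Generators.
Variables (K : fieldType) (n : nat) (A : foxAlg K n) (A' : foxAlg K n.+1).
Hypothesis charK : [pchar K] =i pred0.
Variable emb : {lrmorphism A -> A'}.
Hypothesis emb_x : forall i, emb (fox_x A i) = fox_x A' (widen1 i).
Variables (delta : {linear A' -> A'}) (alpha : 'M[K]_n.+1).
Hypothesis deltaM : forall f g, delta (f * g) = delta f * g + f * delta g.
Hypothesis delta_x :
  forall j, delta (fox_x A' j) = \sum_i alpha i j *: fox_x A' i.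
Hypothesis alphar : forall i, alpha i ord_max = 0.
Hypothesis alphal : forall j, alpha ord_max j = 0.
Notation alpha' := (restr_mx alpha).
Notation ud := ('X_(lshift n.+1 ord_max) : polyUV K n.+1).
Notation vd := ('X_(rshift n.+1 ord_max) : polyUV K n.+1).
Notation v i := ('X_(rshift n i) : polyUV K n).
Notation dv i p := (mderiv (rshift n i) p).
Notation pi p := (fox_pi A' p).
Implicit Types (f g : A').

Lemma emb_act (c : A) p : comm_ideal c ->
  emb (act (fox_x A) c p) = act (fox_x A') (emb c) (poly_widen p).
Proof.
move=> Ic; have Iec : comm_ideal (emb c) by apply: comm_ideal_morph.
apply: (fox_inj charK).
- exact/comm_ideal_morph/act_comm_ideal.
- exact: act_comm_ideal.
apply: ord_widenP => [i|]; last by rewrite fox_act // !(fox_emb_max emb_x) mulr0.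
by rewrite fox_act // !(fox_emb emb_x) fox_act // rmorphM.
Qed.

Lemma fox_delta_max f : fox A' ord_max (delta f) = polyD alpha (fox A' ord_max f).
Proof.
rewrite (fox_delta deltaM delta_x) big1 ?addr0 // => j _.
by rewrite alphal scale0r.
Qed.

Lemma fox_delta_widen i f : fox A' (widen1 i) (delta f) =
  polyD alpha (fox A' (widen1 i) f) + \sum_j alpha' i j *: fox A' (widen1 j) f.
Proof.
rewrite (fox_delta deltaM delta_x) big_ord_widen1 alphar scale0r addr0.
by congr (_ + _); apply: eq_bigr => j _; rewrite mxE.
Qed.

(** On the derivative in x_d this is the commutation of D with E. On the others, the commutator of
    d/dv_i with D supplies the correction term of [fox_delta], and D kills v_d. *)
Lemma delta_pi p : delta (pi p) = pi (polyD alpha' p).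
Proof.
apply: (fox_inj charK); first exact/(delta_comm_ideal deltaM)/fox_pi_comm_ideal.
  exact: fox_pi_comm_ideal.
apply: ord_widenP => [i|]; last first.
  by rewrite fox_delta_max !fox_pi_max polyD_widen // vEuler_polyD.
rewrite fox_delta_widen !fox_pi_widen mderiv_v_polyD linearN /= polyDM.
rewrite polyD_vd // mul0r add0r polyD_widen // !linearD /= mulrDr opprD.
congr (_ + _); rewrite linear_sum mulr_sumr -sumrN; apply: eq_bigr => j _.
by rewrite linearZ /= fox_pi_widen -scalerAr scalerN.
Qed.

(** The Fox derivatives of pi(p) are linear in the first partial derivatives of p, so the chain rule
    carries over to pi. *)
Lemma pi_comp (N : nat) (gs : N.-tuple (polyUV K n)) q :
  pi (q \mPo gs) =
  \sum_j act (fox_x A') (pi (tnth gs j)) (poly_widen (q^`M(j) \mPo gs)).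
Proof.
apply: (fox_inj charK); first exact: fox_pi_comm_ideal.
  by apply: comm_ideal_sum => j _; apply/act_comm_ideal/fox_pi_comm_ideal.
move=> i; rewrite fox_fox_pi [RHS]linear_sum.
under eq_bigr => l _ do rewrite mderiv_comp linear_sum mulr_suml.
rewrite exchange_big; apply: eq_bigr => j _ /=.
rewrite fox_act; last exact: fox_pi_comm_ideal.
rewrite fox_fox_pi mulr_sumr; apply: eq_bigr => l _.
by rewrite rmorphM mulrA.
Qed.

Lemma pi_V_free p : V_free p -> pi p = 0.
Proof.
move=> Vp; apply: (fox_inj charK); first exact: fox_pi_comm_ideal.
  exact: ideal_gen0.
move=> i; rewrite fox_fox_pi linear0 big1 // => j _.
by rewrite V_free_mderiv // linear0 mul0r.
Qed.

Lemma polyD_uvd0 a b : polyD alpha (ud ^+ a * vd ^+ b) = 0.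
Proof.
by rewrite polyDM !polyDX0 ?mul0r ?mulr0 ?addr0 // ?polyD_ud ?polyD_vd.
Qed.

Lemma uvd_coefE_family (I : finType) (r : I -> polyUV K n.+1) : exists B, forall i,
  r i = \sum_(a < B) \sum_(b < B) ud ^+ a * vd ^+ b * poly_widen (uvd_coef a b (r i)).
Proof.
have /fin_all_exists[B rE] i := uvd_coefE (r i).
exists (\max_i B i)%N => i; exact/rE/leq_bigmax.
Qed.

Lemma subtract_pi f : comm_ideal f -> delta f = 0 ->
  exists (B : nat) (P : nat -> nat -> polyUV K n),
    (forall a b, polyD alpha' (P a b) = 0) /\
    fox A' ord_max f = fox A' ord_max
      (\sum_(a < B) \sum_(b < B) act (fox_x A') (pi (P a b)) (ud ^+ a * vd ^+ b)).
Proof.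
move=> If df; pose C a b i := uvd_coef a b (fox A' i f).
have C0 a b : polyD alpha' (C a b ord_max) = 0.
  by rewrite /C -uvd_coef_polyD // -fox_delta_max df !linear0.
(* This is the coefficient of v_d^(b+1) in the Koszul relation: the factor v_d of the last summand
   lowers the exponent to b. It places the coefficient in the ideal generated by the other v_i,
   where E can be inverted. *)
have CE a b : C a b ord_max = - \sum_i v i * C a b.+1 (widen1 i).
  have := congr1 (uvd_coef a b.+1) (fox_koszul If).
  rewrite big_ord_widen1 linear0 linearD /= uvd_coef_mulvd linear_sum.
  move=> e0; apply/eqP; rewrite -addr_eq0 addrC; apply/eqP.
  apply: etrans e0; congr (_ + _); apply: eq_bigr => i _.
  by rewrite /= -uv_widenr -poly_widenX uvd_coef_widen.
pose P a b := vEuler_inv 0 (C a b ord_max).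
have PE a b : vEuler (P a b) = C a b ord_max.
  rewrite /P CE linearN /= linearN /=; congr (- _);
    rewrite (linear_sum (@vEuler_inv K n 0)) (linear_sum (@vEuler K n)); apply: eq_bigr => i _.
  by rewrite /= vEuler_inv0K.
(* The inverse of E commutes with D on multiples of a v_i, so the coefficient is first expanded by
   [CE]. *)
have P0 a b : polyD alpha' (P a b) = 0.
  rewrite -[RHS](linear0 (vEuler_inv 0)) -(C0 a b) /P CE -sumrN.
  rewrite (linear_sum (@vEuler_inv K n 0)) !(linear_sum (polyD alpha')) /=.
  rewrite (linear_sum (@vEuler_inv K n 0)); apply: eq_bigr => i _ /=.
  by rewrite -mulrN vEuler_inv0_polyD.
have [B BE] := uvd_coefE (fox A' ord_max f).
exists B, P; split=> //; rewrite [LHS](BE B) // linear_sum; apply: eq_bigr => a _.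
rewrite linear_sum; apply: eq_bigr => b _ /=.
by rewrite fox_act ?fox_pi_max ?PE //; apply: fox_pi_comm_ideal.
Qed.

(** Without a derivative in x_d, the Koszul relation holds separately for the coefficients of each
    u_d^a v_d^b, and these are then the Fox derivatives of an element of F_{d-1}'. *)
Lemma fox_max0_decomp f : comm_ideal f -> delta f = 0 -> fox A' ord_max f = 0 ->
  exists (B : nat) (k : nat -> nat -> A),
    (forall a b, comm_ideal (k a b) /\ delta (emb (k a b)) = 0) /\
    f = \sum_(a < B) \sum_(b < B) act (fox_x A') (emb (k a b)) (ud ^+ a * vd ^+ b).
Proof.
move=> If df f0; pose h a b i := uvd_coef a b (fox A' (widen1 i) f).
have h0 a b : \sum_i v i * h a b i = 0.
  have := congr1 (uvd_coef a b) (fox_koszul If).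
  rewrite big_ord_widen1 f0 mulr0 addr0 linear0 linear_sum => e0.
  apply: etrans e0; apply: eq_bigr => i _.
  by rewrite /= -uv_widenr -poly_widenX uvd_coef_widen.
pose k a b : A := koszul_inv A (h a b).
have Ik a b : comm_ideal (k a b) by apply: koszul_inv_comm_ideal.
have Iek a b : comm_ideal (emb (k a b)) by apply: comm_ideal_morph.
have kE a b i : fox A i (k a b) = h a b i.
  exact: (fox_koszul_inv A charK i (h0 a b)).
have [B BE] := uvd_coefE_family (fun i => fox A' (widen1 i) f).
exists B, k; split=> [a b|].
  split=> //; apply: (fox_inj charK); first exact: delta_comm_ideal.
    exact: ideal_gen0.
  apply: ord_widenP => [i|]; last first.
    by rewrite fox_delta_max (fox_emb_max emb_x) !linear0.
  rewrite fox_delta_widen (fox_emb emb_x) polyD_widen // kE.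
  under eq_bigr => j _ do rewrite (fox_emb emb_x) kE -linearZ /=.
  rewrite -linear_sum -linearD linear0 -[RHS](linear0 (@poly_widen K n)).
  (* The equation required of [k a b] is the coefficient of u_d^a v_d^b in the i-th derivative of
     [delta f = 0]. *)
  congr poly_widen; have := congr1 (uvd_coef a b \o fox A' (widen1 i)) df.
  rewrite /= fox_delta_widen !linear0 linearD /= uvd_coef_polyD // => e0.
  apply: etrans e0; congr (_ + _); rewrite linear_sum; apply: eq_bigr => j _.
  by rewrite linearZ.
apply: (fox_inj charK) => //.
  by do 2!apply: comm_ideal_sum => ? _; apply: act_comm_ideal.
apply: ord_widenP => [i|]; rewrite linear_sum; last first.
  rewrite f0 big1 // => a _; rewrite linear_sum big1 // => b _.
  by rewrite /= fox_act // (fox_emb_max emb_x) mulr0.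
rewrite [LHS]BE; apply: eq_bigr => a _; rewrite linear_sum; apply: eq_bigr => b _.
by rewrite /= fox_act // (fox_emb emb_x) kE.
Qed.

(** Convertible to the membership condition in [mod_generated_by]. *)
Definition const_span (gs : seq A') f :=
  exists2 p : 'I_(size gs) -> polyUV K n.+1,
    forall i, polyD alpha (p i) = 0 & f = \sum_(i < size gs) act (fox_x A') gs`_i (p i).

Lemma const_span0 gs : const_span gs 0.
Proof.
exists (fun _ => 0) => [i|]; first by rewrite linear0.
by rewrite big1 // => i _; rewrite linear0.
Qed.

Lemma const_spanD gs f g : const_span gs f -> const_span gs g -> const_span gs (f + g).
Proof.
move=> [p p0 ->] [q q0 ->]; exists (fun i => p i + q i) => [i|].
  by rewrite linearD /= p0 q0 addr0.
by rewrite -big_split; apply: eq_bigr => i _; rewrite linearD.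
Qed.

Lemma const_span_sum gs (m : nat) (F : 'I_m -> A') :
  (forall i, const_span gs (F i)) -> const_span gs (\sum_i F i).
Proof.
by move=> SF; apply: big_ind => //; [apply: const_span0 | apply: const_spanD].
Qed.

Lemma const_span_gen gs g r : g \in gs -> polyD alpha r = 0 ->
  const_span gs (act (fox_x A') g r).
Proof.
move=> g_gs r0; have lt_g : (index g gs < size gs)%N by rewrite index_mem.
exists (fun i => if i == Ordinal lt_g then r else 0) => [i|].
  by case: eqP; rewrite ?linear0.
rewrite (sum_delta_l (i := Ordinal lt_g)) => [|i /negbTE ->]; last by rewrite linear0.
by rewrite eqxx nth_index.
Qed.

Section Span.
Variables (cs : seq A) (es fs : seq (polyUV K n)).
Hypothesis csP : forall c, c \in cs -> comm_ideal c /\ delta (emb c) = 0.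
Hypothesis csS : forall f : A, comm_ideal f /\ delta (emb f) = 0 ->
  exists2 p : 'I_(size cs) -> polyUV K n,
    forall i, poly_const alpha' (p i) & f = \sum_(i < size cs) act (fox_x A) cs`_i (p i).
Hypothesis efs : alg_generated_by (poly_const alpha') (es ++ fs).
Hypothesis esV : forall e, e \in es -> V_free e.
Notation gs := (map emb cs ++ map (fox_pi A') fs).

Lemma generator_const g : g \in gs -> comm_ideal g /\ delta g = 0.
Proof.
rewrite mem_cat => /orP[] /mapP[c c_in ->].
  by have [Ic dc] := csP c_in; split=> //; apply: comm_ideal_morph.
split; first exact: fox_pi_comm_ideal.
rewrite delta_pi (_ : polyD alpha' c = 0) ?linear0 //; apply/efs.
(* A generator is the value of a single variable at the generators, hence a constant by [efs]. *)
have lt_c : (index c (es ++ fs) < size (es ++ fs))%N.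
  by rewrite index_mem mem_cat c_in orbT.
exists 'X_(Ordinal lt_c); rewrite comp_mpolyXU /= nth_index //.
by rewrite mem_cat c_in orbT.
Qed.

(** Write p as q evaluated at the generators and apply [pi_comp]. The partial derivatives of q at
    the generators are again constants, and the terms of the [es] vanish because pi kills
    polynomials without V. *)
Lemma const_span_pi p r : polyD alpha' p = 0 -> polyD alpha r = 0 ->
  const_span gs (act (fox_x A') (pi p) r).
Proof.
move=> p0 r0; have [q ->] := (efs p).1 p0.
have Ipi s := fox_pi_comm_ideal A' s.
rewrite pi_comp act_suml //; last by move=> j; apply: act_comm_ideal.
apply: const_span_sum => j; rewrite act_act //.
set g := tnth _ j; set c := poly_widen _.
have c0 : polyD alpha (c * r) = 0.
  rewrite polyDM r0 mulr0 addr0 /c polyD_widen //.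
  suff -> : polyD alpha' (q^`M(j) \mPo in_tuple (es ++ fs)) = 0.
    by rewrite linear0 mul0r.
  by apply/efs; exists (q^`M(j)).
have : g \in es ++ fs by apply: (mem_tnth j (in_tuple (es ++ fs))).
rewrite mem_cat => /orP[/esV /pi_V_free ->|g_fs].
  by rewrite act0; apply: const_span0.
by apply: const_span_gen => //; rewrite mem_cat map_f ?orbT.
Qed.

(** Coefficients that are constants in K[U_{d-1},V_{d-1}] remain constants in K[U_d,V_d], D
    restricting to the smaller ring. *)
Lemma const_span_emb (k : A) r : comm_ideal k -> delta (emb k) = 0 ->
  polyD alpha r = 0 -> const_span gs (act (fox_x A') (emb k) r).
Proof.
move=> Ik dk r0; have [p p0 ->] := csS (conj Ik dk).
have Ic (i : 'I_(size cs)) : comm_ideal cs`_i by case: (csP (mem_nth 0 (ltn_ord i))).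
have Iec (i : 'I_(size cs)) : comm_ideal (emb cs`_i) by apply: comm_ideal_morph.
have Ia (i : 'I_(size cs)) : comm_ideal (emb (act (fox_x A) cs`_i (p i))).
  exact/comm_ideal_morph/act_comm_ideal.
rewrite linear_sum act_suml //; apply: const_span_sum => i.
rewrite /= emb_act // act_act //; apply: const_span_gen.
  by rewrite mem_cat map_f // mem_nth.
by rewrite polyDM r0 mulr0 addr0 polyD_widen // [polyD _ _]p0 linear0 mul0r.
Qed.

Lemma const_span_const f : comm_ideal f -> delta f = 0 -> const_span gs f.
Proof.
move=> If df; have [B [P [P0 fP]]] := subtract_pi If df.
set g := \sum_a _ in fP.
have Ig : comm_ideal g.
  by do 2!apply: comm_ideal_sum => ? _; apply/act_comm_ideal/fox_pi_comm_ideal.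
(* By the product rule for the action, both pi(P a b) and u_d^a v_d^b being constants. *)
have dg : delta g = 0.
  rewrite linear_sum big1 // => a _; rewrite linear_sum big1 // => b _ /=.
  rewrite (delta_act charK _ deltaM delta_x); last exact: fox_pi_comm_ideal.
  by rewrite polyD_uvd0 linear0 addr0 delta_pi P0 linear0 act0.
have Ifg : comm_ideal (f - g) by apply: ideal_genD => //; apply: ideal_genN.
have [|||B' [k [kP fgE]]] := @fox_max0_decomp (f - g); rewrite ?linearB /=.
- exact: Ifg.
- by rewrite df dg subrr.
- by rewrite fP subrr.
rewrite -(subrK g f) {1}fgE; apply: const_spanD.
  apply: const_span_sum => a; apply: const_span_sum => b; have [Ik dk] := kP a b.
  by apply: const_span_emb => //; apply: polyD_uvd0.
by do 2!apply: const_span_sum => ?; apply: const_span_pi => //; apply: polyD_uvd0.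
Qed.

End Span.
End Generators.

(** * The last row and column of the matrix, from the Jordan basis *)

Section JordanMatrix.
Variables (K : fieldType) (n : nat) (delta : {linear FM K n.+1 -> FM K n.+1}).
Variables (alpha : 'M[K]_n.+1) (s : seq nat).
Hypothesis delta_x :
  forall j, delta (FMgen K j) = \sum_(i < n.+1) alpha i j *: FMgen K i.

(** Fox derivatives separate the generators, so the entries of [alpha] can be read off from the
    values of [delta] prescribed by the Jordan basis. *)
Lemma alpha_fox i j : FMfox i (delta (FMgen K j)) = (alpha i j)%:MP.
Proof. exact: (fox_delta_x (A := FM_foxAlg K n.+1) delta_x). Qed.

Lemma last_cell_offset :
  sumn s = n.+1 -> last 0%N s = 1%N -> reshape_offset s n = 0%N.
Proof.
case/lastP: s => [|t k] //; rewrite last_rcons sumn_rcons => + k1.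
rewrite k1 addn1 => -[tn].
(* Counting from 0, variable n opens the last cell, which has index [size t] and starts at
   [sumn t = n]. *)
have := @flatten_indexKr (rcons t 1) (size t) 0.
rewrite nth_rcons ltnn eqxx /flatten_index -cats1 take_size_cat // tn addn0.
exact.
Qed.

Hypothesis jordan : jordan_basis delta s.
Hypothesis last1 : last 0%N s = 1%N.

Lemma alpha_col_max i : alpha i ord_max = 0.
Proof.
have [sn _ d0 _] := jordan; apply: (can_inj (@mpolyCK (n.+1 + n.+1) K)).
by rewrite -alpha_fox d0 ?linear0 //; apply: last_cell_offset.
Qed.

(** Each [delta] of a generator is 0 or the generator just before it, which is never the last
    one. *)
Lemma alpha_row_max j : alpha ord_max j = 0.
Proof.
have [sn _ d0 d1] := jordan; apply: (can_inj (@mpolyCK (n.+1 + n.+1) K)).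
rewrite -alpha_fox; have [/d0 ->|oj] := eqVneq (reshape_offset s j) 0%N.
  exact: linear0.
(* The very first variable has offset 0, so a nonzero offset provides a predecessor. *)
have j_gt0 : (0 < j)%N by case: posnP oj => // ->.
have ltj : (j.-1 < n.+1)%N by rewrite prednK // ltnW.
rewrite (d1 (Ordinal ltj) j) ?prednK // FMfox_gen.
have /negbTE -> // : ord_max != Ordinal ltj.
by apply/eqP => /(congr1 val) /= e; have := ltn_ord j; rewrite -(prednK j_gt0) -e ltnn.
Qed.

End JordanMatrix.

(* d = n.+1, and x_d is the generator of index ord_max *)
Theorem corollary4p4 (K : fieldType) (n : nat)
    (delta : {linear FM K n.+1 -> FM K n.+1}) (alpha : 'M[K]_n.+1)
    (s : seq nat) (cs : seq (FM K n)) (es fs : seq {mpoly K[n + n]}) :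
  [pchar K] =i pred0 ->
  weitzenboeck delta alpha ->
  jordan_basis delta s ->
  last 0%N s = 1%N ->
  (forall c, c \in cs -> homogeneous s c) ->
  mod_generated_by (poly_const (restr_mx alpha))
    (fun f : FM K n => comm_ideal f /\ delta (FMemb f) = 0) cs ->
  alg_generated_by (poly_const (restr_mx alpha)) (es ++ fs) ->
  (forall e, e \in es -> V_free e) ->
  (forall f, f \in fs -> V_dependent f) ->
  mod_generated_by (poly_const alpha)
    (fun f : FM K n.+1 => comm_ideal f /\ delta f = 0)
    (map (@FMemb K n) cs ++ map (@pi_map K n) fs).
Proof.
move=> charK [deltaM delta_x _ _] jordan last1 _ [csP csS] efs esV _.
have alphar := alpha_col_max delta_x jordan last1.
have alphal := alpha_row_max delta_x jordan.
pose A := FM_foxAlg K n; pose A' := FM_foxAlg K n.+1.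
split=> [c c_in|f [If df]].
  (* On [FM_foxAlg] the maps [fox_pi] and [pi_map] are convertible, so the abstract statements apply
     as they stand. *)
  exact: (@generator_const K n A A' charK (@FMemb K n) delta alpha deltaM delta_x
    alphar alphal cs es fs csP efs c c_in).
exact: (@const_span_const K n A A' charK (@FMemb K n) (@FMemb_gen K n) delta alpha
  deltaM delta_x alphar alphal cs es fs csP csS efs esV f If df).
Qed.
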